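(* Let $1<p<\infty$ and suppose that $\gamma^{p/2}\in L^1_{\mathrm{loc}}(E)$, where $\gamma(x)=|Q(x)|_{\mathrm{op}}$. Then the quadratic form $\mathcal{Q}$ has the $p$-Neumann property on $E$ (with respect to the weight $v$) if and only if $\mathcal{Q}$ has the Poincaré property of order $p$ on $E$ (with respect to $v$).
   Context: Setting: $\Omega\subset\mathbb{R}^n$ is a domain and $E$ is a bounded open set with $\overline{E}\subset\Omega$. $\mathcal{S}_n$ is the set of real symmetric positive semi-definite $n\times n$ matrices; $Q:\Omega\to\mathcal{S}_n$ has Lebesgue measurable entries, $\sqrt{Q(x)}$ is its positive semi-definite square root, $\mathcal{Q}(x,\xi)=\xi^tQ(x)\xi$ and $\gamma(x)=|Q(x)|_{\mathrm{op}}=\sup_{|\xi|=1}|Q(x)\xi|$. $v$ is a weight on $\Omega$ (a non-negative function in $L^1_{\mathrm{loc}}(\Omega)$) with $v(E)=\int_E v\,dx>0$; $\|f\|_{L^p(v;E)}=(\int_E|f|^pv\,dx)^{1/p}$ and $f_E=\frac{1}{v(E)}\int_E f v\,dx$. Spaces: $\mathcal{L}^p_Q(E)$ is the space of measurable $\mathbf{f}:E\to\mathbb{R}^n$ with $\|\mathbf{f}\|_{\mathcal{L}^p_Q(E)}=(\int_E|\sqrt{Q}\,\mathbf{f}|^p\,dx)^{1/p}<\infty$, with $\mathbf f,\mathbf g$ identified when $\|\mathbf f-\mathbf g\|_{\mathcal{L}^p_Q(E)}=0$. $H^{1,p}_Q(v;E)$ is the completion of $\{f\in C^1(\overline{E}):\|f\|_{H^{1,p}_Q(v;E)}<\infty\}$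 with respect to $\|f\|_{H^{1,p}_Q(v;E)}=\|f\|_{L^p(v;E)}+\|\nabla f\|_{\mathcal{L}^p_Q(E)}$. Each of its elements is represented by the unique pair $(u,\mathbf{g})\in L^p(v;E)\times\mathcal{L}^p_Q(E)$ that is the limit of $(f_k,\nabla f_k)$ for a Cauchy sequence $f_k$ representing it, with norm $\|u\|_{L^p(v;E)}+\|\mathbf g\|_{\mathcal{L}^p_Q(E)}$ ($\mathbf g$ need not be determined by $u$). $\tilde{H}^{1,p}_Q(v;E)=\{(u,\mathbf g)\in H^{1,p}_Q(v;E):\int_E u\,v\,dx=0\}$. A function $\varphi\in C^1(\overline E)$ of finite norm is identified with the pair $(\varphi,\nabla\varphi)$. Poincaré property of order $p$ on $E$: there is a constant $C_p>0$ such that for all $f\in C^1(\overline{E})$, $\int_E|f-f_E|^p v\,dx\le C_p\int_E|\sqrt{Q}\,\nabla f|^p\,dx$. Weak solution: given $f\in L^p(v;E)$, a pair $(u,\mathbf g)\in\tilde{H}^{1,p}_Q(v;E)$ is a weak solution of the weighted homogeneous Neumann problem $\operatorname{div}(|\sqrt{Q}\nabla u|^{p-2}Q\nabla u)=|f|^{p-2}f\,v$ in $E$, $\mathbf n^t\cdot Q\nabla u=0$ on $\partial E$, if for all $\varphi\in C^1(\overline{E})\cap\tilde{H}^{1,p}_Q(v;E)$, $$\int_E|\sqrt{Q}\,\mathbf g|^{p-2}(\nabla\varphi)^tQ\,\mathbf g\,dx=-\int_E|f|^{p-2}f\,\varphi\,v\,dx$$ (expressions $|s|^{p-2}s$ are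 $0$ at $s=0$, and $|\sqrt Q\mathbf g|^{p-2}Q\mathbf g=0$ where $\sqrt Q\mathbf g=0$). No regularity of $\partial E$ is assumed; this integral identity is the definition. $p$-Neumann property on $E$: (1) for every $f\in L^p(v;E)$ there exists a weak solution $(u,\mathbf g)_f\in\tilde{H}^{1,p}_Q(v;E)$ of the Neumann problem with data $f$; and (2) there is a constant $D_p=D_p(v,E)>0$ such that for every $f\in L^p(v;E)$ every weak solution $(u,\mathbf g)_f\in\tilde{H}^{1,p}_Q(v;E)$ satisfies $\|u\|_{L^p(v;E)}\le D_p\|f\|_{L^p(v;E)}$. *)

(* Defs.v *)
From HB Require Import structures.
From mathcomp Require Import all_boot all_order all_algebra.
From mathcomp Require Import all_classical all_reals all_analysis.

Set Implicit Arguments.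
Unset Strict Implicit.
Unset Printing Implicit Defensive.

Import Order.TTheory GRing.Theory Num.Theory.
Import numFieldNormedType.Exports.

Local Open Scope classical_set_scope.
Local Open Scope ring_scope.

(** Points of $\mathbb{R}^{n+1}$ are row vectors ['rV[R]_n.+1], which carry the
    product topology; values of vector fields are column vectors, so that
    $\xi^t Q \xi$ is written as usual.  The library's norm on matrices is the
    max norm: [enorm] below is the Euclidean one. *)

(** Lebesgue measure: Caratheodory's construction from coverings by half-open
    boxes $\prod_i (a_i, b_i]$. *)
Section lebesgue_nd.
Variables (R : realType) (n : nat).
Local Notation V := 'rV[R]_n.+1.

Definition box (ab : V * V) : set V :=
  [set x | forall i, ab.1 0 i < x 0 i <= ab.2 0 i].

Definition box_vol (ab : V * V) : R :=
  \prod_i Num.max 0 (ab.2 0 i - ab.1 0 i).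

Lemma box_vol_ge0 ab : 0 <= box_vol ab.
Proof. by apply: prodr_ge0 => i _; rewrite le_max lexx. Qed.

Local Open Scope ereal_scope.

Definition lebesgue_outer (A : set V) : \bar R :=
  ereal_inf [set \sum_(k <oo) (box_vol (ab k))%:E |
             ab in [set ab : nat -> V * V | A `<=` \bigcup_k box (ab k)]].

Let vol_ge0 ab : 0 <= (box_vol ab)%:E.
Proof. by rewrite lee_fin box_vol_ge0. Qed.

Let lebesgue_outer_ge0 A : 0 <= lebesgue_outer A.
Proof.
by apply: le_ereal_inf_tmp => _ [ab _ <-]; apply: nneseries_ge0 => *.
Qed.

Let lebesgue_outer0 : lebesgue_outer set0 = 0.
Proof.
apply/eqP; rewrite eq_le lebesgue_outer_ge0 andbT.
apply: ereal_inf_lbound; exists (fun=> (0%R, 0%R)) => //.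
rewrite eseries0// => k _ _; congr (_%:E).
by rewrite /box_vol big_ord_recl subrr maxxx mul0r.
Qed.

Let le_lebesgue_outer :
  {homo lebesgue_outer : A B / A `<=` B >-> A <= B}.
Proof.
move=> A B AB; apply/ereal_inf_le_tmp => x [ab Bab <-].
by exists ab => //; exact: subset_trans Bab.
Qed.

Let lebesgue_outer_sigma_subadditive : sigma_subadditive lebesgue_outer.
Proof.
move=> A; have [[i ioo]|] := pselect (exists i, lebesgue_outer (A i) = +oo).
  rewrite (eseries_pinfty _ _ ioo) ?leey// => k _.
  by rewrite -ltNye (lt_le_trans _ (lebesgue_outer_ge0 _)).
rewrite -forallNE => Aoo.
suff add2e (e : {posnum R}) : lebesgue_outer (\bigcup_k A k) <=
    \sum_(i <oo) lebesgue_outer (A i) + e%:num%:E.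
  by apply/lee_addgt0Pr => _/posnumP[].
rewrite (le_trans _ (epsilon_trick _ _ _))//.
pose P k (ab : nat -> V * V) := A k `<=` \bigcup_j box (ab j) /\
  \sum_(j <oo) (box_vol (ab j))%:E <=
    lebesgue_outer (A k) + (e%:num / (2 ^ k.+1)%:R)%:E.
have [G PG] : {G : nat -> nat -> V * V & forall k, P k (G k)}.
  apply: (@choice _ _ P) => k.
  have fk : lebesgue_outer (A k) \is a fin_num.
    by rewrite ge0_fin_numE// ltey; apply/eqP/Aoo.
  have ek : (0 < e%:num / (2 ^ k.+1)%:R)%R by [].
  have [_ [ab Aab <-] /ltW] := lb_ereal_inf_adherent ek fk.
  by exists ab.
pose g := fun ij => (box_vol (uncurry G ij))%:E.
have g_ge0 x : 0 <= g x by exact: vol_ge0.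
apply: (@le_trans _ _ (\esum_(i in setT) g i)).
  apply: ereal_inf_lbound => /=.
  have /card_esym/ppcard_eqP[f] := card_nat2.
  exists (uncurry G \o f) => /=.
    move=> t [i _ /(PG i).1[j _ Gt]]; exists (f^-1%FUN (i, j)) => //=.
    by rewrite invK ?inE.
  rewrite -(esum_pred_image g _ xpredT) ?[fun=> _]set_true//.
  by rewrite image_eq.
rewrite (_ : esum _ _ = \sum_(i <oo) \sum_(j <oo) g (i, j)); last first.
  pose J : nat -> set (nat * nat) := fun i => [set (i, j) | j in setT].
  rewrite (_ : setT = \bigcup_k J k); last first.
    by rewrite predeqE => -[a b]; split => // _; exists a => //; exists b.
  rewrite esum_bigcupT //=; last first.
    apply/trivIsetP => i j _ _ ij.
    rewrite predeqE => -[k m] /=; split => //= -[] [_] _ [<-{k} _].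
    by move=> [m' _] [] /esym/eqP; rewrite (negbTE ij).
  rewrite -(image_id [set: nat]) -fun_true esum_pred_image//; last first.
    by move=> k _; exact: esum_ge0.
  apply: eq_eseriesr => /= j _.
  rewrite -(esum_pred_image g (pair j) predT)//=; last first.
    by move=> ? ? _ _; exact: (@can_inj _ _ _ snd).
  by congr esum; rewrite predeqE => -[a b]; split; move=> [i _ <-]; exists i.
apply: lee_nneseries => [i _ _|i _]; last exact: (PG i).2.
by apply: nneseries_ge0 => *; exact: g_ge0.
Qed.

HB.instance Definition _ := isOuterMeasure.Build R V lebesgue_outer
  lebesgue_outer0 lebesgue_outer_ge0 le_lebesgue_outer
  lebesgue_outer_sigma_subadditive.

Definition lebesgue_nd : set (caratheodory_type lebesgue_outer) -> \bar R :=
  lebesgue_outer.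
HB.instance Definition _ := isMeasure.Build _ (caratheodory_type lebesgue_outer)
  R lebesgue_nd
  (@caratheodory_measure0 R V lebesgue_outer)
  (@caratheodory_measure_ge0 R V lebesgue_outer)
  (@caratheodory_measure_sigma_additive R V lebesgue_outer).

End lebesgue_nd.

(** $\mathbb{R}^{n+1}$ with the $\sigma$-algebra of Lebesgue measurable sets *)
Notation lebesgue_space R n := (caratheodory_type (@lebesgue_outer R n)).

Section matrices.
Variables (R : realType) (n : nat).

Definition qform (A : 'M[R]_n) (xi : 'cV[R]_n) : R := (xi^T *m A *m xi) 0 0.

Definition psd (A : 'M[R]_n) : Prop := A^T = A /\ forall xi, 0 <= qform A xi.

(** A positive semi-definite matrix has exactly one positive semi-definite
    square root, so [xget] picks that one. *)
Definition mxsqrt (A : 'M[R]_n) : 'M[R]_n :=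
  xget 0 [set S | psd S /\ S *m S = A].

Definition enorm (xi : 'cV[R]_n) : R := Num.sqrt (\sum_i xi i 0 ^+ 2).

Definition opnorm (A : 'M[R]_n) : R :=
  sup [set enorm (A *m xi) | xi in [set xi | enorm xi = 1]].

End matrices.

Section spaces.
Variables (R : realType) (n : nat).
Local Notation V := 'rV[R]_n.+1.
Local Notation vec := 'cV[R]_n.+1.
Local Notation T := (lebesgue_space R n).
Local Notation mu := (@lebesgue_nd R n).

Definition loc_integrable (D : set V) (f : V -> R) : Prop :=
  measurable_fun (D : set T) (f : T -> R) /\
  forall K : set V, K `<=` D -> compact K ->
    (\int[mu]_(x in K) `|f x|%:E < +oo)%E.

Definition weight (D : set V) (v : V -> R) : Prop :=
  (forall x, D x -> 0 <= v x) /\ loc_integrable D v.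

Definition partial (i : 'I_n.+1) (f : V -> R) (x : V) : R :=
  'D_(delta_mx 0 i) f x.

Definition grad (f : V -> R) (x : V) : vec := \col_i partial i f x.

Definition extends_to_closure (E : set V) (f : V -> R) : Prop :=
  exists h : V -> R,
    {within closure E, continuous h} /\ forall x, E x -> h x = f x.

(** $C^1(\overline E)$, for an open set [E]: $f$ is $C^1$ in [E], and $f$ and
    its first order partial derivatives extend continuously to $\overline E$.
    Only the values of [f] on [E] matter. *)
Definition C1_closure (E : set V) (f : V -> R) : Prop :=
  [/\ forall x, E x -> differentiable f x,
      extends_to_closure E f &
      forall i, extends_to_closure E (partial i f)].

Variables (E : set V) (v : V -> R) (Q : V -> 'M[R]_n.+1) (p : R).

Definition vmass : R := (\int[mu]_(x in E) v x)%R.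

Definition vmean (f : V -> R) : R := vmass^-1 * (\int[mu]_(x in E) (f x * v x))%R.

Definition Lpnorm (f : V -> R) : \bar R :=
  ((\int[mu]_(x in E) (`|f x| `^ p * v x)%:E) `^ p^-1)%E.

Definition LpQnorm (g : V -> vec) : \bar R :=
  ((\int[mu]_(x in E) (enorm (mxsqrt (Q x) *m g x) `^ p)%:E) `^ p^-1)%E.

(** Elements of the spaces below are given by representatives of their
    equivalence classes. *)
Definition in_Lp (f : V -> R) : Prop :=
  measurable_fun (E : set T) (f : T -> R) /\ (Lpnorm f < +oo)%E.

Definition in_LpQ (g : V -> vec) : Prop :=
  (forall i, measurable_fun (E : set T) ((fun x => g x i 0) : T -> R)) /\
  (LpQnorm g < +oo)%E.

Definition in_H (u : V -> R) (g : V -> vec) : Prop :=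
  [/\ in_Lp u, in_LpQ g &
    exists f : nat -> V -> R,
      [/\ forall k, C1_closure E (f k) /\
            (Lpnorm (f k) + LpQnorm (grad (f k)) < +oo)%E,
          Lpnorm (fun x => f k x - u x) @[k --> \oo] --> 0%E &
          LpQnorm (fun x => grad (f k) x - g x) @[k --> \oo] --> 0%E]].

Definition in_Htilde (u : V -> R) (g : V -> vec) : Prop :=
  in_H u g /\ (\int[mu]_(x in E) (u x * v x)%:E = 0)%E.

Definition poincare_property : Prop :=
  exists2 C : R, 0 < C & forall f : V -> R, C1_closure E f ->
    (\int[mu]_(x in E) (`|f x - vmean f| `^ p * v x)%:E <=
     C%:E * \int[mu]_(x in E) (enorm (mxsqrt (Q x) *m grad f x) `^ p)%:E)%E.

(** The conventions at the zeros of $f$ and of $\sqrt Q\,\mathbf g$ hold for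
    every [p] because the accompanying factor vanishes there. *)
Definition weak_solution (f u : V -> R) (g : V -> vec) : Prop :=
  in_Htilde u g /\
  forall phi : V -> R, C1_closure E phi -> in_Htilde phi (grad phi) ->
    (\int[mu]_(x in E) (enorm (mxsqrt (Q x) *m g x) `^ (p - 2) *
                        ((grad phi x)^T *m Q x *m g x) 0 0)%:E =
     - \int[mu]_(x in E) (`|f x| `^ (p - 2) * f x * phi x * v x)%:E)%E.

Definition neumann_property : Prop :=
  (forall f, in_Lp f -> exists u g, weak_solution f u g) /\
  exists2 D : R, 0 < D & forall f, in_Lp f -> forall u g,
    weak_solution f u g -> (Lpnorm u <= D%:E * Lpnorm f)%E.

End spaces.

(* Main.v *)
Require Import Defs.
From mathcomp Require Import all_boot all_order all_algebra.
From mathcomp Require Import all_classical all_reals all_analysis measurable_realfun.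
From mathcomp Require Import spectral sesquilinear complex polyrcf ring lra.
Import Order.TTheory GRing.Theory Num.Theory.
Import numFieldNormedType.Exports.
Local Open Scope classical_set_scope.
Local Open Scope ring_scope.

(** For p > 1 put N_S(g) = \int_E |S g|^p and B_S(g,h) = \int_E |S g|^(p-2) h^t S^2 g;
    the two spaces of the statement are the cases S = v^(1/p) (1 x 1 matrices) and
    S = sqrt(Q).  Homogeneity lets Young's inequality in the form
    a^(p-1) b <= e a^p + e^(1-p) b^p replace both Hoelder's and Minkowski's.

    Testing the equation with approximants of the solution itself (made of mean
    zero) gives the energy identity N_Q(g) = - B_v(f, u).  Under the Poincare
    inequality this bounds N_v(u) by N_v(f); conversely, if phi has mean zero and
    (u, g) solves the problem with data phi, testing with phi gives
    N_v(phi) = - B_Q(g, grad phi), while N_Q(g) = - B_v(phi, u) <= (1 + K) N_v(phi),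
    and Young's inequality yields the Poincare inequality.

    Solutions are found by minimizing N_Q(grad phi) + p B_v(f, phi) over C^1
    functions of mean zero.  No weak compactness is needed: the inequality
    |a-b|^p <= e(|a|^p+|b|^p) + C(|a|^p+|b|^p-2|(a+b)/2|^p) makes minimizing sequences
    Cauchy.  Completeness of L^p_Q requires a measurable field g with
    Q g = lim Q g_k, which is obtained by Tikhonov regularization. *)

Set Implicit Arguments.
Unset Strict Implicit.
Unset Printing Implicit Defensive.

(** * Inequalities for real powers *)

(** [mxsqrt] picks the root of Q point by point, whereas measurability is given for Q. Hence
    measurability is always carried by S^2: norms are read as square roots of g^t S^2 g, and limits
    of fields are recorded as limits of S^2 g_k. This is what turns completeness into the problem of
    solving S^2 g = W measurably for a possibly singular S. As g is not determined by u, no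
    closability is at hand: the sequences f_k and grad f_k are made Cauchy separately, the second by
    convexity and the first by the Poincare inequality. The term e(|a|^p + |b|^p) in the convexity
    inequality cannot be dropped for p < 2: near a nonzero a the defect is only quadratic in a - b,
    so no multiple of it dominates |a - b|^p. With this term close pairs are absorbed, and all p > 1
    are treated alike. Minimality is tested only through the tangent inequality N(g + h) >= N(g) + p
    B(g, h), so the Euler equation requires continuity of B along lines and no derivative of N. *)

Section powR_inequalities.
Variables (R : realType) (p : R).
Hypothesis p1 : 1 < p.

Let p0 : 0 < p. Proof. exact: lt_trans p1. Qed.
Let ple0 : 0 <= p. Proof. exact: ltW. Qed.
Let pm1 : 0 < p - 1. Proof. by rewrite subr_gt0. Qed.

Lemma powR_le (a b q : R) : 0 <= q -> 0 <= a -> a <= b -> a `^ q <= b `^ q.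
Proof.
by move=> q0 a0 ab; apply: ge0_ler_powR => //; rewrite nnegrE // (le_trans a0).
Qed.

Lemma powRB1 (a : R) : 0 <= a -> a `^ (p - 1) * a = a `^ p.
Proof. by move=> a0; rewrite mulrC mulr_powRB1. Qed.

(** One of the two terms on the right is enough, according to whether b <= e a or a <= b / e. No
    conjugate exponent enters. *)
Lemma young_eps (e a b : R) : 0 < e -> 0 <= a -> 0 <= b ->
  a `^ (p - 1) * b <= e * a `^ p + e `^ (1 - p) * b `^ p.
Proof.
move=> e0 a0 b0; have [bea|/ltW eab] := leP b (e * a).
  rewrite -(powRB1 a0) ler_wpDr ?mulr_ge0 ?powR_ge0//.
  by rewrite mulrCA ler_wpM2l ?powR_ge0.
rewrite ler_wpDl ?mulr_ge0 ?powR_ge0 ?(ltW e0)// -(powRB1 b0) mulrA.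
rewrite ler_wpM2r// -[1 - p]opprB powRN -powR_inv1 ?powR_ge0// -powRrM.
rewrite mulrN1 powRN ler_pdivlMl ?powR_gt0//.
by rewrite -powRM ?(ltW e0)//; apply: powR_le; rewrite ?(ltW pm1)// mulr_ge0// ltW.
Qed.

Lemma powR_addl_le (h a b : R) : 0 < h -> 0 <= a -> 0 <= b ->
  (a + b) `^ p <= (1 + h) `^ p * a `^ p + (1 + h^-1) `^ p * b `^ p.
Proof.
move=> h0 a0 b0; have hi0 : 0 < h^-1 by rewrite invr_gt0.
have [bha|/ltW hab] := leP b (h * a).
  rewrite ler_wpDr ?mulr_ge0 ?powR_ge0// -powRM//; last by lra.
  by apply: powR_le => //; [lra | rewrite mulrDl mul1r lerD2l].
rewrite ler_wpDl ?mulr_ge0 ?powR_ge0// -powRM//; last by lra.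
apply: powR_le => //; [lra | rewrite mulrDl mul1r addrC lerD2l].
by rewrite ler_pdivlMl.
Qed.

Lemma powR_add_le (a b : R) : 0 <= a -> 0 <= b ->
  (a + b) `^ p <= 2 `^ p * (a `^ p + b `^ p).
Proof.
by move=> a0 b0; rewrite mulrDr (le_trans (powR_addl_le ltr01 a0 b0)) ?invr1.
Qed.

(** This is Young's inequality for b and a^(p-1) with exponents p and q = p / (p - 1), multiplied by
    p; unlike a derivative argument it includes a = 0. *)
Lemma powR_tangent (a b : R) : 0 <= a -> 0 <= b ->
  a `^ p + p * a `^ (p - 1) * (b - a) <= b `^ p.
Proof.
move=> a0 b0; pose q := p / (p - 1).
have q0 : 0 < q by rewrite divr_gt0.
have pq : p^-1 + q^-1 = 1.
  by rewrite /q invf_div -{1}(div1r p) -mulrDl subrKC mulfV// gt_eqF.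
have := conjugate_powR b0 (powR_ge0 a (p - 1)) p0 q0 pq.
have -> : (a `^ (p - 1)) `^ q = a `^ p.
  by rewrite -powRrM /q mulrCA mulfV ?mulr1// gt_eqF.
rewrite -(ler_pM2l p0) mulrDr => H.
have E0 : p * (b `^ p / p) = b `^ p by field; rewrite gt_eqF.
have E1 : p * (a `^ p / q) = (p - 1) * a `^ p.
  by rewrite /q invf_div; field; rewrite gt_eqF.
move: H; rewrite E0 E1 -(powRB1 a0).
set X := a `^ _; set Y := b `^ _ => H; nra.
Qed.

(** The mean value theorem on each half of [s, 1] compares the two increments: the halves have equal
    length and the derivative is strictly increasing. *)
Lemma powR_midpoint_lt (s : R) : 0 < s -> s < 1 ->
  2 * ((1 + s) / 2) `^ p < 1 + s `^ p.
Proof.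
move=> s0 s1; set m := (1 + s) / 2.
have sm : s < m by rewrite /m; lra.
have m1 : m < 1 by rewrite /m; lra.
pose f := fun t : R => t `^ p.
have fd (t : R) : 0 < t -> is_derive t 1 f (p * t `^ (p - 1)).
  move=> t0; have tin : t \in `]0, +oo[ by rewrite in_itv/= t0.
  rewrite -(powR_derive1 p tin) derive1E.
  exact/derivableP/derivable_powR.
have fc (a b : R) : 0 < a -> {within `[a, b], continuous f}.
  move=> a0; apply: continuous_in_subspaceT => x; rewrite inE/= in_itv/= => /andP[ax _].
  apply: differentiable_continuous; apply/derivable1_diffP.
  by apply: derivable_powR; rewrite in_itv/= (lt_le_trans a0).
have H (a b : R) : 0 < a -> a < b -> exists2 c, c \in `]a, b[%R & f b - f a = p * c `^ (p - 1) * (b - a).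
  move=> a0 ab; apply: (MVT ab); last exact: fc.
  by move=> x; rewrite in_itv/= => /andP[ax _]; apply: fd; exact: lt_trans ax.
have [c1 c1i E1] := H _ _ s0 sm.
have [c2 c2i E2] := H _ _ (lt_trans s0 sm) m1.
move: c1i c2i; rewrite !in_itv/= => /andP[sc1 c1m] /andP[mc2 c21].
have lt12 : c1 `^ (p - 1) < c2 `^ (p - 1).
  by apply: gt0_ltr_powR; rewrite // ?nnegrE; lra.
have f1 : f 1 = 1 by rewrite /f powR1.
rewrite -[s `^ p]/(f s) -[m `^ p]/(f m).
suff : f m - f s < f 1 - f m by rewrite f1; lra.
rewrite E1 E2; have -> : 1 - m = m - s by rewrite /m; field.
by rewrite ltr_pM2r ?subr_gt0// ltr_pM2l.
Qed.

(** In the weighted sum of the tangent inequalities at the mean m, the linear terms cancel. *)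
Lemma powR_convex (l a b : R) : 0 <= l <= 1 -> 0 <= a -> 0 <= b ->
  (l * a + (1 - l) * b) `^ p <= l * a `^ p + (1 - l) * b `^ p.
Proof.
move=> l01 a0 b0.
have [/andP[l0 l1]] := (l01, l01) => _.
set m := l * a + (1 - l) * b.
have m0 : 0 <= m by rewrite addr_ge0// mulr_ge0// subr_ge0.
have Ha := powR_tangent m0 a0; have Hb := powR_tangent m0 b0.
set D := p * _ in Ha Hb.
have := lerD (ler_wpM2l l0 Ha) (ler_wpM2l (_ : 0 <= 1 - l) Hb).
rewrite subr_ge0 => /(_ l1); apply: le_trans.
rewrite le_eqVlt; apply/orP; left; apply/eqP.
by rewrite /m; set X := _ `^ p; ring.
Qed.

(* The defect is antitone in [s] because (s, m', m') majorizes (s', m, m), where m and m' are the midpoints of s, 1 and of s', 1. *)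
Lemma powR_midpoint_antitone (s s' : R) : 0 <= s -> s <= s' -> s' < 1 ->
  1 + s' `^ p - 2 * ((1 + s') / 2) `^ p <= 1 + s `^ p - 2 * ((1 + s) / 2) `^ p.
Proof.
move=> s0 ss' s'1; set m := (1 + s) / 2; set m' := (1 + s') / 2.
have d0 : 0 < m' - s by rewrite /m'; lra.
(* These are the weights of s when s' and m are written as convex combinations of s and m'. Since l
   + 2k = 1, the first convexity inequality plus twice the second is s'^p + 2 m^p <= s^p + 2
   m'^p. *)
pose l := (m' - s') / (m' - s); pose k := (m' - m) / (m' - s).
have l01 : 0 <= l <= 1.
  apply/andP; split; first by rewrite divr_ge0 ?(ltW d0)// /m'; lra.
  by rewrite ler_pdivrMr// mul1r lerD2l lerN2.
have k01 : 0 <= k <= 1.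
  apply/andP; split; first by rewrite divr_ge0 ?(ltW d0)// /m' /m; lra.
  by rewrite ler_pdivrMr// mul1r lerD2l lerN2 /m; lra.
have m'0 : 0 <= m' by rewrite /m'; lra.
have lk : l + 2 * k = 1.
  by rewrite /l /k; rewrite /m' in d0 *; rewrite /m; field; rewrite gt_eqF//; lra.
have Hl := powR_convex l01 s0 m'0; have Hk := powR_convex k01 s0 m'0.
have El : l * s + (1 - l) * m' = s' by rewrite /l; field; rewrite gt_eqF.
have Ek : k * s + (1 - k) * m' = m by rewrite /k; field; rewrite gt_eqF.
rewrite El in Hl; rewrite Ek in Hk.
move: Hl Hk; have -> : l = 1 - 2 * k by lra.
set A := s `^ p; set B := m' `^ p; set C := s' `^ p; set D := m `^ p.
by move=> H1 H2; nra.
Qed.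

(** The longer vector is normalized to length 1. If s stays away from 1, strict midpoint convexity
    bounds the defect below. If s is close to 1 that bound degenerates, but then c^2 <= 1 - d^2 < 1
    - e^2 keeps the midpoint short. *)
Lemma powR_unif_convex_aux (e : R) : 0 < e -> e < 1 ->
  exists2 D : R, 0 < D & forall s c d : R, 0 <= s -> s <= 1 -> 0 <= c ->
    1 + s ^+ 2 = 2 * c ^+ 2 + 2 * d ^+ 2 -> c <= (1 + s) / 2 -> e < d ->
    D <= 1 + s `^ p - 2 * c `^ p.
Proof.
move=> e0 e1; pose k := (1 - e ^+ 2) `^ (p / 2).
have ee1 : e ^+ 2 < 1 by rewrite expr_lt1// ltW.
have k0 : 0 < k by rewrite powR_gt0// subr_gt0.
have k1 : k < 1.
  rewrite [ltRHS](_ : 1 = 1 `^ (p / 2)); last by rewrite powR1.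
  apply: gt0_ltr_powR; rewrite ?divr_gt0// ?nnegrE ?subr_ge0 ?ltW//.
  by rewrite ltrBlDr ltrDl exprn_gt0.
(* The threshold puts s0^p midway between k and 1, so that 1 + s0^p - 2k = 3(1 - k)/2 is
   positive. *)
pose s0 := ((1 + k) / 2) `^ p^-1.
have s00 : 0 < s0 by rewrite powR_gt0//; lra.
have s0p : s0 `^ p = (1 + k) / 2.
  by rewrite -powRrM mulVf ?gt_eqF// powRr1//; lra.
have s01 : s0 < 1.
  rewrite [ltRHS](_ : 1 = 1 `^ p^-1); last by rewrite powR1.
  by apply: gt0_ltr_powR; rewrite ?invr_gt0// ?nnegrE; lra.
pose D1 := 1 + s0 `^ p - 2 * ((1 + s0) / 2) `^ p.
have D10 : 0 < D1 by have := powR_midpoint_lt s00 s01; rewrite /D1; lra.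
exists (Num.min D1 (3 * (1 - k) / 2)); first by rewrite lt_min D10/=; lra.
move=> s c d sge0 s1 c0 E cs ed; rewrite ge_min; apply/orP.
have [ss0|/ltW s0s] := leP s s0; [left|right].
  apply: le_trans (powR_midpoint_antitone sge0 ss0 s01) _.
  by rewrite lerD2l lerN2 ler_pM2l//; apply: powR_le.
have e2d : e ^+ 2 <= d ^+ 2 by rewrite lerXn2r ?nnegrE//; lra.
have s21 : s ^+ 2 <= 1 by rewrite expr_le1.
have ck : c `^ p <= k.
  have -> : c `^ p = (c ^+ 2) `^ (p / 2).
    by rewrite -powR_mulrn// -powRrM; congr (_ `^ _); field.
  by apply: powR_le; rewrite ?divr_ge0// ?sqr_ge0//; lra.
have := powR_le ple0 (ltW s00) s0s; rewrite s0p; lra.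
Qed.

(** Here r, s, c, d stand for |a|, |b|, |a + b|/2 and |a - b|/2; of the geometry only the
    parallelogram law and the triangle inequality remain. *)
Lemma powR_unif_convex (e : R) : 0 < e ->
  exists2 C : R, 0 < C & forall r s c d : R, 0 <= r -> 0 <= s -> 0 <= c -> 0 <= d ->
    r ^+ 2 + s ^+ 2 = 2 * c ^+ 2 + 2 * d ^+ 2 -> c <= (r + s) / 2 ->
    d `^ p <= e * (r `^ p + s `^ p) + C * (r `^ p + s `^ p - 2 * c `^ p).
Proof.
(* If d <= h r, then d^p <= e r^p and the first term suffices; the cap 1/2 makes h an admissible
   threshold for the normalized inequality. *)
move=> e_gt0; pose h := Num.min (e `^ p^-1) (2^-1).
have h0 : 0 < h by rewrite lt_min powR_gt0//=; lra.
have h1 : h < 1 by rewrite gt_min; apply/orP; right; lra.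
have hp : h `^ p <= e.
  have -> : e = (e `^ p^-1) `^ p by rewrite -powRrM mulVf ?gt_eqF// powRr1// ltW.
  by apply: powR_le => //; [exact: ltW | rewrite ge_min lexx].
have [D D0 HD] := powR_unif_convex_aux h0 h1.
exists D^-1; first by rewrite invr_gt0.
have defect_ge0 (r s c : R) : 0 <= r -> 0 <= s -> 0 <= c -> c <= (r + s) / 2 ->
    0 <= r `^ p + s `^ p - 2 * c `^ p.
  move=> r0 s0 c0 cs; have l01 : 0 <= (2^-1 : R) <= 1 by apply/andP; split; lra.
  have := powR_convex l01 r0 s0.
  have -> : 2^-1 * r + (1 - 2^-1) * s = (r + s) / 2 by field.
  have : c `^ p <= ((r + s) / 2) `^ p by exact: powR_le.
  lra.
have main (r s c d : R) : 0 < r -> 0 <= s -> s <= r -> 0 <= c -> 0 <= d ->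
    r ^+ 2 + s ^+ 2 = 2 * c ^+ 2 + 2 * d ^+ 2 -> c <= (r + s) / 2 ->
    d `^ p <= e * (r `^ p + s `^ p) + D^-1 * (r `^ p + s `^ p - 2 * c `^ p).
  move=> r0 s0 sr c0 d0 E cs.
  have rp0 : 0 < r `^ p by rewrite powR_gt0.
  have G := defect_ge0 _ _ _ (ltW r0) s0 c0 cs.
  have [dh|hd] := leP d (h * r).
    rewrite ler_wpDr ?mulr_ge0 ?invr_ge0 ?(ltW D0)//.
    apply: (@le_trans _ _ (h `^ p * r `^ p)).
      by rewrite -powRM ?(ltW h0) ?(ltW r0)//; exact: powR_le.
    by rewrite ler_pM ?powR_ge0// lerDl powR_ge0.
  rewrite ler_wpDl ?mulr_ge0 ?addr_ge0 ?powR_ge0 ?(ltW e_gt0)//.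
  have r1 : 0 <= r^-1 by rewrite invr_ge0 ltW.
  have := HD (s / r) (c / r) (d / r); rewrite !divr_ge0 ?(ltW r0)//.
  rewrite ler_pdivrMr// mul1r => /(_ isT sr isT) HD'.
  have {}HD' : D <= 1 + (s / r) `^ p - 2 * (c / r) `^ p.
    apply: HD'.
    - have rn : r != 0 by rewrite gt_eqF.
      apply: (@mulIf _ (r ^+ 2)); first by rewrite expf_neq0.
      transitivity (r ^+ 2 + s ^+ 2); first by field.
      by rewrite E; field.
    - rewrite ler_pdivrMr//; apply: le_trans cs _.
      by rewrite le_eqVlt; apply/orP; left; apply/eqP; field; rewrite gt_eqF.
    - by rewrite ltr_pdivlMr.
  (* From 2 d^2 <= r^2 + s^2 <= 2 r^2; thus it is enough that the defect is at least D r^p. *)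
  have drp : d `^ p <= r `^ p.
    apply: powR_le => //; rewrite -(@ler_pXn2r _ 2)// ?nnegrE ?(ltW r0)//.
    have : s ^+ 2 <= r ^+ 2 by rewrite lerXn2r ?nnegrE// ltW.
    by have := sqr_ge0 c; lra.
  rewrite ler_pdivlMl// (le_trans (ler_wpM2l (ltW D0) drp))//.
  rewrite !powRM// in HD'; move: (ler_wpM2r (ltW rp0) HD').
  rewrite (_ : (1 + _ - _) * _ =
    r `^ p + s `^ p * (r^-1 `^ p * r `^ p) - 2 * c `^ p * (r^-1 `^ p * r `^ p)); last by ring.
  by rewrite -powRM ?(ltW r0)// mulVf ?gt_eqF// powR1 !mulr1.
move=> r s c d r0 s0 c0 d0 E cs.
have [sr|/ltW rs] := leP s r; last first.
  have [s_eq0|s_gt0] := leP s 0; last first.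
    by rewrite (addrC (r `^ p)); apply: main => //; rewrite addrC.
  have {}s_eq0 : s = 0 by lra.
  have rz : r = 0 by lra.
  have dz : d = 0.
    by apply/eqP; rewrite -sqrf_eq0 eq_le sqr_ge0 andbT; move: E; have := sqr_ge0 c; rewrite rz s_eq0 !expr0n/=; lra.
  rewrite dz powR0 ?gt_eqF//; apply: addr_ge0; apply: mulr_ge0 => //; [exact: ltW|by rewrite addr_ge0 ?powR_ge0|by rewrite invr_ge0 ltW|].
  exact: defect_ge0.
have [r_eq0|r_gt0] := leP r 0; last exact: main.
have {}r_eq0 : r = 0 by lra.
have sz : s = 0 by lra.
have dz : d = 0.
  by apply/eqP; rewrite -sqrf_eq0 eq_le sqr_ge0 andbT; move: E; have := sqr_ge0 c; rewrite r_eq0 sz !expr0n/=; lra.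
rewrite dz powR0 ?gt_eqF//; apply: addr_ge0; apply: mulr_ge0 => //; [exact: ltW|by rewrite addr_ge0 ?powR_ge0|by rewrite invr_ge0 ltW|].
exact: defect_ge0.
Qed.
End powR_inequalities.

(** * Euclidean norm and square roots of matrices *)

Section euclidean_norm.
Variables (R : realType) (m : nat).
Implicit Types a b : 'cV[R]_m.

Definition dot a b : R := \sum_i a i 0 * b i 0.

Lemma dotC a b : dot a b = dot b a.
Proof. by apply: eq_bigr => i _; rewrite mulrC. Qed.

Lemma dotDl a b c : dot (a + b) c = dot a c + dot b c.
Proof. by rewrite /dot -big_split/=; apply: eq_bigr => i _; rewrite mxE mulrDl. Qed.

Lemma dotZl k a c : dot (k *: a) c = k * dot a c.
Proof. by rewrite /dot mulr_sumr; apply: eq_bigr => i _; rewrite mxE mulrA. Qed.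

Lemma dotDr a b c : dot c (a + b) = dot c a + dot c b.
Proof. by rewrite dotC dotDl !(dotC c). Qed.

Lemma dotZr k a c : dot c (k *: a) = k * dot c a.
Proof. by rewrite dotC dotZl (dotC c). Qed.

Lemma dot_ge0 a : 0 <= dot a a.
Proof. by apply: sumr_ge0 => i _; rewrite -expr2 sqr_ge0. Qed.

Lemma dotE a b : dot a b = (a^T *m b) 0 0.
Proof. by rewrite mxE; apply: eq_bigr => i _; rewrite mxE. Qed.

Lemma dot_mulmx (A : 'M[R]_m) a b : dot a (A *m b) = dot (A^T *m a) b.
Proof. by rewrite !dotE trmx_mul trmxK mulmxA. Qed.

Lemma enorm_ge0 a : 0 <= enorm a. Proof. exact: sqrtr_ge0. Qed.

Lemma enorm_sqr a : enorm a ^+ 2 = dot a a.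
Proof.
rewrite /enorm; under eq_bigr do rewrite expr2.
by rewrite sqr_sqrtr// dot_ge0.
Qed.

Lemma enorm0 : enorm (0 : 'cV[R]_m) = 0.
Proof.
by rewrite /enorm big1 ?sqrtr0// => i _; rewrite mxE expr0n.
Qed.

Lemma enormZ k a : enorm (k *: a) = `|k| * enorm a.
Proof.
rewrite /enorm -sqrtr_sqr -sqrtrM ?sqr_ge0//; congr Num.sqrt.
by rewrite mulr_sumr; apply: eq_bigr => i _; rewrite mxE exprMn.
Qed.

Lemma enormN a : enorm (- a) = enorm a.
Proof. by rewrite -scaleN1r enormZ normrN1 mul1r. Qed.

Lemma enorm_eq0 a : enorm a = 0 -> a = 0.
Proof.
move=> a0; have : dot a a = 0 by rewrite -enorm_sqr a0 expr0n.
move/eqP; rewrite psumr_eq0; last by move=> i _; rewrite -expr2 sqr_ge0.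
move=> /allP H; apply/matrixP => i j; rewrite ord1 mxE; apply/eqP.
by have := H i (mem_index_enum i); rewrite /= -expr2 sqrf_eq0.
Qed.

Lemma dot_le a b : dot a b <= enorm a * enorm b.
Proof.
have [b0|b0] := eqVneq (enorm b) 0.
  by rewrite (enorm_eq0 b0) enorm0 mulr0 /dot big1// => i _; rewrite mxE mulr0.
have bp : 0 < enorm b by rewrite lt0r b0 enorm_ge0.
have [a0|a0] := eqVneq (enorm a) 0.
  by rewrite (enorm_eq0 a0) enorm0 mul0r /dot big1// => i _; rewrite mxE mul0r.
have ap : 0 < enorm a by rewrite lt0r a0 enorm_ge0.
(* The square of |b| a - |a| b expands to 2 |a| |b| (|a| |b| - a.b), whose first factors are
   positive here. *)
have := dot_ge0 (enorm b *: a + (- enorm a) *: b).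
rewrite !(dotDl, dotDr, dotZl, dotZr) (dotC b a) -!enorm_sqr.
move: (enorm a) (enorm b) (dot a b) ap bp {a0 b0} => x y z x0 y0 H.
have : 0 <= 2 * (x * y) * (x * y - z) by nra.
by rewrite pmulr_rge0 ?subr_ge0// !mulr_gt0.
Qed.

Lemma normr_dot_le a b : `|dot a b| <= enorm a * enorm b.
Proof.
rewrite ler_norml dot_le andbT lerNl.
by rewrite -mulN1r -dotZl scaleN1r (le_trans (dot_le _ _))// enormN.
Qed.

Lemma enormD a b : enorm (a + b) <= enorm a + enorm b.
Proof.
rewrite -(@ler_pXn2r _ 2)// ?nnegrE ?addr_ge0 ?enorm_ge0//.
rewrite enorm_sqr !(dotDl, dotDr) (dotC b a) -!enorm_sqr.
by have := dot_le a b; move=> H; rewrite sqrrD; lra.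
Qed.

Lemma enorm_dist a b : `|enorm a - enorm b| <= enorm (a - b).
Proof.
rewrite ler_norml; apply/andP; split.
  have := enormD (b - a) a; rewrite subrK -(enormN (a - b)) opprB; lra.
have := enormD (a - b) b; rewrite subrK; lra.
Qed.

Lemma enorm_parallelogram a b :
  enorm a ^+ 2 + enorm b ^+ 2 =
  2 * enorm (2^-1 *: (a + b)) ^+ 2 + 2 * enorm (2^-1 *: (a - b)) ^+ 2.
Proof.
rewrite !enorm_sqr -scaleN1r !(dotZl, dotZr, dotDl, dotDr) (dotC b a).
by field.

Qed.

End euclidean_norm.

Section psd_sqrt.
Variable R : realType.

(* A function of a symmetric matrix is a polynomial in it, so the square root stays real although the diagonalization is complex. *)
Lemma poly_interpolation (h : R -> R) (s : seq R) :
  exists q : {poly R}, {in s, forall x, q.[x] = h x}.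
Proof.
elim: s => [|a s [q IH]]; first by exists 0.
have [as_|as_] := boolP (a \in s).
  by exists q => x; rewrite inE => /orP[/eqP ->|]; exact: IH.
pose w := \prod_(b <- s) ('X - b%:P).
have wa : w.[a] != 0 by rewrite -rootE root_prod_XsubC.
exists (q + ((h a - q.[a]) / w.[a]) *: w) => x.
rewrite inE !hornerE => /orP[/eqP ->|xs]; first by rewrite divfK// subrKC.
have /rootP -> : root w x by rewrite root_prod_XsubC.
by rewrite mulr0 addr0 IH.
Qed.

Lemma psd_eigenvalue_ge0 n (A : 'M[R]_n) (a : R) : psd A -> eigenvalue A a -> 0 <= a.
Proof.
move=> [As Ap] /eigenvalueP[v vA v0].
have := Ap v^T; rewrite /qform trmxK vA -scalemxAl mxE => H.
have vv : (v *m v^T) 0 0 = dot v^T v^T by rewrite dotE trmxK.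
rewrite vv in H; have : 0 < dot v^T v^T.
  rewrite lt0r dot_ge0 andbT; apply: contra v0 => /eqP d0.
  by rewrite -[v]trmxK (@enorm_eq0 _ _ v^T) ?trmx0//; apply/eqP; rewrite -sqrf_eq0 enorm_sqr d0.
by move=> d0; rewrite -(pmulr_lge0 _ d0).
Qed.

Lemma sym_horner_mx n (A : 'M[R]_n.+1) (q : {poly R}) : A^T = A -> (horner_mx A q)^T = horner_mx A q.
Proof.
move=> As; elim/poly_ind: q => [|q c IH]; first by rewrite rmorph0 trmx0.
rewrite rmorphD rmorphM /= horner_mx_X horner_mx_C linearD/= tr_scalar_mx.
rewrite -mulmxE trmx_mul As IH; congr (_ + _).
have := congr1 (horner_mx A) (mulrC q 'X); rewrite !rmorphM /= horner_mx_X => /esym.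
exact.
Qed.

(** Over the complex numbers A is Hermitian, hence unitarily diagonalizable with real spectrum, and
    f annihilates the diagonal form entry by entry. *)
Lemma horner_mx_sym_eq0 n (A : 'M[R]_n.+1) (f : {poly R}) : A^T = A ->
  (forall a, eigenvalue A a -> f.[a] = 0) -> horner_mx A f = 0.
Proof.
move=> As fA; pose Ac := map_mx (real_complex R) A.
have Ach : Ac \is hermsymmx.
  apply: realsym_hermsym.
    by apply/is_hermitianmxP; rewrite expr0 scale1r map_mx_id// /Ac; apply/matrixP => i j; rewrite !mxE -{1}As mxE.
  by apply/mxOverP => i j; rewrite mxE; apply/complex_realP; exists (A i j).
have /hermitian_normalmx /orthomx_spectralP E := Ach.
have Dr := hermitian_spectral_diag_real Ach.
set P := spectralmx Ac in E; set D := spectral_diag Ac in E Dr.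
have Pu : P \in unitmx by exact: spectral_unit.
have : horner_mx Ac (map_poly (real_complex R) f) = 0.
  rewrite E horner_mx_uconjC// horner_mx_diag.
  suff -> : map_mx (horner (map_poly (real_complex R) f)) D = 0.
    by rewrite (_ : diag_mx 0 = 0) ?mulmx0 ?mul0mx//; apply/matrixP => i j; rewrite !mxE mul0rn.
  apply/matrixP => i j; rewrite ord1 !mxE.
  have /mxOverP /(_ 0 j) /complex_realP[d De] := Dr.
  rewrite De horner_map fA ?rmorph0//.
  (* The diagonal entry d is an eigenvalue of the complexified matrix, with row j of P as
     eigenvector; being real, it is a root of the characteristic polynomial of A itself. *)
  rewrite eigenvalue_root_char -(fmorph_root (real_complex R)) map_char_poly /= -De.
  rewrite -eigenvalue_root_char; apply/eigenvalueP; exists (row j P).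
    rewrite -row_mul -/Ac {1}E !mulmxA mulmxV// mul1mx row_mul row_diag_mx.
    by rewrite -scalemxAl -rowE.
  apply: contraTneq Pu => rP0; rewrite unitmxE unitfE negbK.
  apply/det0P; exists (delta_mx 0 j).
    by apply/eqP => /matrixP/(_ 0 j); rewrite !mxE !eqxx => /eqP; rewrite oner_eq0.
  by rewrite -rowE.
rewrite -map_horner_mx => /eqP; rewrite map_mx_eq0 => /eqP //.
Qed.

Lemma psd_sqrt_exists n (A : 'M[R]_n.+1) : psd A -> exists S, psd S /\ S *m S = A.
Proof.
move=> pA; have As := pA.1.
(* Interpolating the fourth root makes the square root r(A)^2 the square of a symmetric matrix, so
   its positivity is immediate. *)
have [r Hr] := @poly_interpolation (fun x => Num.sqrt (Num.sqrt x))
  (rootsR (char_poly A)).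
have Sq : horner_mx A ((r ^+ 2) ^+ 2 - 'X) = 0.
  apply: horner_mx_sym_eq0 => // a ea; rewrite !hornerE Hr.
    by rewrite !sqr_sqrtr ?sqrtr_ge0 ?subrr// (psd_eigenvalue_ge0 pA ea).
  rewrite -roots_on_rootsR ?monic_neq0 ?char_poly_monic//=.
  by rewrite -eigenvalue_root_char.
exists (horner_mx A (r ^+ 2)); split; last first.
  apply/eqP; rewrite -subr_eq0; move: Sq.
  by rewrite rmorphB /= horner_mx_X expr2 rmorphM => ->.
have rs := sym_horner_mx r As.
split; first exact: sym_horner_mx.
move=> xi; rewrite /qform expr2 rmorphM /= -mulmxE -!mulmxA [xi^T *m _]mulmxA.
by rewrite -{1}rs -trmx_mul -dotE; exact: dot_ge0.
Qed.

Lemma mxsqrtP n (A : 'M[R]_n.+1) : psd A -> (mxsqrt A)^T = mxsqrt A /\ mxsqrt A *m mxsqrt A = A.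
Proof.
move=> /psd_sqrt_exists[S HS]; rewrite /mxsqrt; case: xgetP => [T _ [[? _] ?] //|].
by move/(_ S); rewrite /= => /(_ HS).
Qed.

End psd_sqrt.

(** * Measurable matrix fields *)

Section measurable_matrix.
Context d (T : measurableType d) (R : realType).
Variable E : set T.

Definition mx_measurable a b (F : T -> 'M[R]_(a, b)) :=
  forall i j, measurable_fun E (fun x => F x i j).

Lemma mx_measurable_mul a b c (F : T -> 'M[R]_(a, b)) (G : T -> 'M[R]_(b, c)) :
  mx_measurable F -> mx_measurable G -> mx_measurable (fun x => F x *m G x).
Proof.
move=> mF mG i j.
rewrite (_ : (fun _ => _) = fun x => \sum_k F x i k * G x k j); last first.
  by apply/funext => x; rewrite mxE.
by apply: measurable_sum => k; exact: measurable_funM.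
Qed.

Lemma mx_measurableD a b (F G : T -> 'M[R]_(a, b)) :
  mx_measurable F -> mx_measurable G -> mx_measurable (fun x => F x + G x).
Proof.
move=> mF mG i j.
under eq_fun do rewrite mxE.
exact: measurable_funD.
Qed.

Lemma mx_measurableZ a b (c : T -> R) (F : T -> 'M[R]_(a, b)) :
  measurable_fun E c -> mx_measurable F -> mx_measurable (fun x => c x *: F x).
Proof.
move=> mc mF i j.
under eq_fun do rewrite mxE.
exact: measurable_funM.
Qed.

Lemma mx_measurable_cst a b (M : 'M[R]_(a, b)) : mx_measurable (fun=> M).
Proof. by move=> i j; exact: measurable_cst. Qed.

Lemma mx_measurable_tr a b (F : T -> 'M[R]_(a, b)) :
  mx_measurable F -> mx_measurable (fun x => (F x)^T).
Proof. by move=> mF i j; under eq_fun do rewrite mxE; exact: mF. Qed.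

Lemma measurable_det a (F : T -> 'M[R]_a) :
  mx_measurable F -> measurable_fun E (fun x => \det (F x)).
Proof.
move=> mF; rewrite /determinant; apply: measurable_sum => s.
apply: measurable_funM; first exact: measurable_cst.
by apply: measurable_prod => i _; exact: mF.
Qed.

Lemma mx_measurable_adj a (F : T -> 'M[R]_a) :
  mx_measurable F -> mx_measurable (fun x => \adj (F x)).
Proof.
move=> mF i j; under eq_fun do rewrite mxE /cofactor.
apply: measurable_funM; first exact: measurable_cst.
apply: measurable_det => k l; under eq_fun do rewrite !mxE.
exact: mF.
Qed.

(** Writing 1/y as y (y^2)^(-1) reduces to a real power of a non-negative function; at y = 0 both
    sides are 0. *)
Lemma measurable_inv (f : T -> R) :
  measurable_fun E f -> measurable_fun E (fun x => (f x)^-1).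
Proof.
move=> mf; rewrite (_ : (fun _ => _) = fun x => f x * (f x ^+ 2) `^ (-1)).
  apply: measurable_funM => //.
  apply: (measurableT_comp (f := @powR R ^~ (-1)) (g := fun x => f x ^+ 2)).
    exact: measurable_powR.
  by under eq_fun do rewrite expr2; exact: measurable_funM.
apply/funext => x; rewrite powR_inv1 ?sqr_ge0//.
have [->|f0] := eqVneq (f x) 0; first by rewrite invr0 mul0r.
by field.
Qed.

End measurable_matrix.

Lemma cvg_dist_le (R : realType) (u a : nat -> R) (l : R) :
  (forall k, `|u k - l| <= a k) -> a k @[k --> \oo] --> 0 -> u k @[k --> \oo] --> l.
Proof.
move=> ua a0; apply/subr_cvg0; apply/norm_cvg0P.
by apply: (squeeze_cvgr _ (cvg_cst (0 : R)) a0); near=> k; rewrite normr_ge0 ua.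
Unshelve. all: by end_near. Qed.

(** * Ranges of symmetric matrices and regularized inversion *)

Section range_of_gram_matrix.
Variables (R : realType) (m : nat).
Implicit Types (A S : 'M[R]_m).

Lemma coord_le_enorm (a : 'cV[R]_m) i : `|a i 0| <= enorm a.
Proof.
rewrite -sqrtr_sqr /enorm ler_wsqrtr//.
by rewrite (bigD1 i)//= lerDl; apply: sumr_ge0 => j _; rewrite sqr_ge0.
Qed.

(** Membership in the range is a finite system of linear equations, given by the cokernel matrix,
    and each equation passes to the limit. *)
Lemma range_closed A (g : nat -> 'cV[R]_m) (w : 'cV[R]_m) :
  (forall i, (A *m g k) i 0 @[k --> \oo] --> w i 0) -> exists z, w = A *m z.
Proof.
move=> gw; have : (w^T <= A^T)%MS.
  rewrite submxE; apply/eqP/matrixP => i j; rewrite ord1 [RHS]mxE.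
  have E k : ((A *m g k)^T *m cokermx A^T) 0 j = 0.
    by rewrite trmx_mul -mulmxA mulmx_coker mulmx0 mxE.
  have : ((A *m g k)^T *m cokermx A^T) 0 j @[k --> \oo] --> (w^T *m cokermx A^T) 0 j.
    rewrite mxE; under eq_cvg do rewrite mxE.
    apply: (cvg_big add_continuous) => l _; apply: cvgMr_tmp.
    by rewrite mxE; under eq_cvg do rewrite mxE; exact: gw.
  by under eq_cvg do rewrite E; move/cvg_lim => <-//; rewrite lim_cst.
move=> /submxP[D wD]; exists D^T.
by rewrite -[w]trmxK wD trmx_mul trmxK.
Qed.

(** For symmetric A the kernels of A^2 and A coincide, as |A v|^2 = v.(A^2 v); equal ranks then give
    equal ranges. It provides a solution of A g = w that lies in the range of A. *)
Lemma range_sqr A : A^T = A -> forall z : 'cV[R]_m, exists y, A *m z = A *m (A *m y).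
Proof.
move=> As z.
have kerAA (v : 'rV[R]_m) : v *m (A *m A) = 0 -> v *m A = 0.
  move=> vAA; rewrite -[v *m A]trmxK; suff -> : (v *m A)^T = 0 by rewrite trmx0.
  apply: enorm_eq0; apply/eqP; rewrite -sqrf_eq0 enorm_sqr dotE trmxK trmx_mul As.
  by rewrite -mulmxA [A *m (A *m _)]mulmxA mulmxA vAA mul0mx mxE.
have kk : (kermx (A *m A) <= kermx A)%MS.
  by apply/rV_subP => v /sub_kermxP /kerAA; move/sub_kermxP.
have sAA : (A *m A <= A)%MS by exact: submxMl.
have AA : (A <= A *m A)%MS.
  have [_ <-] := mxrank_leqif_sup sAA.
  rewrite eqn_leq (mxrankS sAA)/=; have := mxrankS kk; rewrite !mxrank_ker => H.
  have := rank_leq_row A; have := rank_leq_row (A *m A).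
  move: H; move: (\rank A) (\rank (A *m A)) => a b H Hb Ha.
  by rewrite -(leq_sub2lE _ Ha).
have /submxP[D zD] : (z^T *m A <= A *m A)%MS by exact: submx_trans (submxMl _ _) AA.
exists D^T; apply: trmx_inj; rewrite trmx_mul As zD.
by rewrite !trmx_mul trmxK As mulmxA.
Qed.

(* Tikhonov regularization: [(A + e)^-1 w], written with the adjugate so that it is visibly measurable in [A] and [w], tends to the minimal norm solution of [A g = w] as [e] tends to 0. *)
Definition tikhonov A (w : 'cV[R]_m) (e : R) : 'cV[R]_m :=
  (\det (A + e%:M))^-1 *: (\adj (A + e%:M) *m w).

(** With w = A A y, the regularized solution is A y - e u where A (y - u) = e u. Pairing this with y
    - u and using A >= 0 gives |u|^2 <= y.u, hence |u| <= |y| and an error of at most e |y|. *)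
Lemma tikhonov_cvg A (w : 'cV[R]_m) : A^T = A -> (forall z, 0 <= dot z (A *m z)) ->
  (exists z, w = A *m z) ->
  exists2 g, A *m g = w &
    forall i, tikhonov A w k.+1%:R^-1 i 0 @[k --> \oo] --> g i 0.
Proof.
move=> As Ap [z0 wz0]; have [y zy] := range_sqr As z0.
have wy : w = A *m (A *m y) by rewrite wz0.
exists (A *m y) => // i.
have sol e : 0 < e -> (A + e%:M) *m tikhonov A w e = w.
  (* A kernel vector v of A + e would satisfy v.(A v) = - e |v|^2 < 0. *)
  move=> e0; have : \det (A + e%:M) != 0.
    apply/negP => /eqP d0; have : \det (A + e%:M)^T = 0 by rewrite det_tr.
    move=> /eqP/det0P[v v0 /(congr1 trmx)].
    rewrite trmx_mul trmxK trmx0 mulmxDl mul_scalar_mx => /(congr1 (dot v^T)).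
    rewrite dotDr dotZr => H; move: (Ap v^T).
    have -> : dot v^T (A *m v^T) = - (e * dot v^T v^T).
      by move/eqP: H; rewrite [X in _ == X](_ : _ = 0) ?addr_eq0 => [/eqP//|]; rewrite /dot big1// => j _; rewrite !mxE mulr0.
    have dv : 0 < dot v^T v^T.
      rewrite lt0r dot_ge0 andbT; apply: contra v0 => /eqP d0'.
      by rewrite -[v]trmxK (@enorm_eq0 _ _ v^T) ?trmx0//; apply/eqP; rewrite -sqrf_eq0 enorm_sqr d0'.
    by rewrite oppr_ge0 leNgt mulr_gt0.
  move=> dn; rewrite /tikhonov -scalemxAr mulmxA mul_mx_adj mul_scalar_mx.
  by rewrite scalerA mulVf// scale1r.
have bnd e : 0 < e -> `|tikhonov A w e i 0 - (A *m y) i 0| <= e * enorm y.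
  move=> e0; set x := tikhonov A w e.
  have [u Ex] : exists u, x = A *m y - e *: u /\ enorm u <= enorm y.
    pose u := e^-1 *: (A *m y - x).
    have eu : e *: u = A *m y - x by rewrite scalerA mulfV ?scale1r ?gt_eqF.
    exists u; split; first by rewrite eu subKr.
    have Ax : A *m x + e *: x = A *m (A *m y).
      by rewrite -wy -(sol e e0) mulmxDl mul_scalar_mx.
    have Au : A *m (y - u) = e *: u.
      have E1 : e *: (A *m u) = e *: x.
        by rewrite -linearZ/= -/x eu mulmxBr -Ax addrAC subrr add0r.
      have {}E1 : A *m u = x.
        have en0 : e != 0 by rewrite gt_eqF.
        by rewrite -[A *m u]scale1r -(mulVf en0) -scalerA E1 scalerA mulVf// scale1r.
      by rewrite mulmxBr E1 eu.
    have := Ap (y - u); rewrite Au dotZr pmulr_rge0// -scaleN1r dotDl dotZl mulN1r subr_ge0.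
    rewrite -enorm_sqr => H; have [u0|u0] := eqVneq (enorm u) 0.
      by rewrite u0 enorm_ge0.
    have up : 0 < enorm u by rewrite lt0r u0 enorm_ge0.
    rewrite -(ler_pM2r up) -expr2; exact: le_trans H (dot_le _ _).
  case: Ex => -> uy.
  rewrite (_ : _ - _ = - e * u i 0); last by rewrite !mxE; ring.
  rewrite normrM normrN (gtr0_norm e0) ler_pM2l//.
  exact: le_trans (coord_le_enorm _ _) uy.
apply: (cvg_dist_le (a := fun k => k.+1%:R^-1 * enorm y)).
  by move=> k; apply: bnd; rewrite invr_gt0.
rewrite -[X in _ --> X](mul0r (enorm y)); apply: cvgMr_tmp; exact: cvg_harmonic.
Qed.
End range_of_gram_matrix.

(** * Energy spaces *)

Section fast_cauchy.
Variables (R : realType) (m : nat).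

Lemma enorm_cvg (a : nat -> 'cV[R]_m) (V : 'cV[R]_m) :
  (forall i, a k i 0 @[k --> \oo] --> V i 0) -> enorm (a k) @[k --> \oo] --> enorm V.
Proof.
move=> aV; have H : \sum_i a k i 0 ^+ 2 @[k --> \oo] --> \sum_i V i 0 ^+ 2.
  apply: (cvg_big add_continuous) => i _; rewrite expr2; under eq_cvg do rewrite expr2.
  by apply: cvgM; exact: aV.
exact: (cvg_comp _ _ H (@sqrt_continuous R _)).
Qed.

Lemma cvg_of_geometric_steps (a : nat -> R) (K : R) :
  (forall j, `|a j.+1 - a j| <= K * 2^-1 ^+ j) -> cvgn a.
Proof.
move=> aK; rewrite (_ : a = fun n => a 0%N + series (telescope a) n); last first.
  by apply/funext => n; exact: eq_sum_telescope.
apply: is_cvgD; first exact: is_cvg_cst.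
apply: normed_cvg; apply: (@series_le_cvg _ _ (geometric K 2^-1)) => //.
- by move=> n; exact: normr_ge0.
- by move=> n; exact: (le_trans (normr_ge0 _) (aK n)).
- by apply: is_cvg_geometric_series; rewrite ger0_norm// invf_lt1// ltr1n.
Qed.

Lemma fast_cauchy_cvg (a : nat -> 'cV[R]_m) (K : R) :
  (forall j, enorm (a j.+1 - a j) <= K * 2^-1 ^+ j) ->
  exists2 V : 'cV[R]_m, (forall i, a k i 0 @[k --> \oo] --> V i 0) &
    forall j, enorm (a j - V) <= 2 * K * 2^-1 ^+ j.
Proof.
move=> aK; have K0 : 0 <= K by have := aK 0%N; rewrite expr0 mulr1; exact/le_trans/enorm_ge0.
have c i : cvgn (fun k => a k i 0).
  apply: (@cvg_of_geometric_steps _ K) => j; apply: le_trans (aK j).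
  by have := coord_le_enorm (a j.+1 - a j) i; rewrite !mxE.
exists (\col_i limn (fun k => a k i 0)) => [i|j]; first by rewrite mxE; exact: c.
have tail l : enorm (a j - a (j + l)%N) <= 2 * K * 2^-1 ^+ j.
  (* The factor 1 - 2^-l makes the bound inductive: it is the exact partial sum of the geometric
     series of steps. *)
  suff : enorm (a j - a (j + l)%N) <= 2 * K * 2^-1 ^+ j * (1 - 2^-1 ^+ l).
    move/le_trans; apply; apply: ler_piMr.
      by rewrite !mulr_ge0// exprn_ge0.
    by rewrite gerBl exprn_ge0.
  elim: l => [|l IH]; first by rewrite addn0 subrr enorm0 expr0 subrr mulr0.
  have -> : a j - a (j + l.+1)%N = (a j - a (j + l)%N) + - (a (j + l).+1 - a (j + l)%N).
    by rewrite addnS opprB addrA subrK.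
  apply: le_trans (enormD _ _) _; rewrite enormN.
  apply: le_trans (lerD IH (aK _)) _.
  rewrite exprD exprS le_eqVlt; apply/orP; left; apply/eqP.
  by field.
have Hc : enorm (a j - a (j + l)%N) @[l --> \oo] --> enorm (a j - \col_i limn (fun k => a k i 0)).
  apply: enorm_cvg => i; rewrite !mxE; under eq_cvg do rewrite !mxE.
  apply: cvgB; first exact: cvg_cst.
  have H : [sequence (fun k => a k i 0) (n + j)%N]_n @ \oo --> limn (fun k => a k i 0).
    by rewrite (cvg_shiftn j (fun k => a k i 0)); exact: c.
  by under eq_cvg do rewrite addnC.
by rewrite -(cvg_lim _ Hc)//; apply: limr_le; [apply/cvg_ex; eexists; exact: Hc | apply: nearW].
Qed.

End fast_cauchy.

Section fast_cauchy_seminorm.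
Variables (R : realType) (m : nat) (S : 'M[R]_m).
Hypothesis S_sym : S^T = S.

Lemma sym_sqr_ge0 (z : 'cV[R]_m) : 0 <= dot z (S *m S *m z).
Proof. by rewrite -mulmxA dot_mulmx S_sym dot_ge0. Qed.

(** Since |S (z - g)|^2 = (z - g).S^2 (z - g); equations solved for the measurable S^2 thereby come
    back to S. *)
Lemma sym_sqr_eq (z g : 'cV[R]_m) : S *m S *m z = S *m S *m g -> S *m z = S *m g.
Proof.
move=> zg; apply/eqP; rewrite -subr_eq0; apply/eqP; apply: enorm_eq0.
apply/eqP; rewrite -sqrf_eq0 enorm_sqr -mulmxBr -{1}S_sym -dot_mulmx mulmxA.
by rewrite mulmxBr zg subrr /dot big1// => i _; rewrite [X in _ * X]mxE mulr0.
Qed.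

Lemma mulmx_cvg a (M : 'M[R]_(a, m)) (w : nat -> 'cV[R]_m) (V : 'cV[R]_m) :
  (forall i, w k i 0 @[k --> \oo] --> V i 0) ->
  forall i, (M *m w k) i 0 @[k --> \oo] --> (M *m V) i 0.
Proof.
move=> wV i; rewrite mxE; under eq_cvg do rewrite mxE.
by apply: (cvg_big add_continuous) => l _; apply: cvgMl_tmp; exact: wV.
Qed.

(* Only [S w_k] converges: [w_k] itself is controlled merely modulo the kernel of [S]. *)
Lemma fast_cauchy_seminorm (w : nat -> 'cV[R]_m) (K : R) :
  (forall j, enorm (S *m (w j.+1 - w j)) <= K * 2^-1 ^+ j) ->
  exists W : 'cV[R]_m, (forall i, (S *m S *m w k) i 0 @[k --> \oo] --> W i 0) /\
  exists2 g, S *m S *m g = W &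
    (forall i, tikhonov (S *m S) W k.+1%:R^-1 i 0 @[k --> \oo] --> g i 0) /\
    forall j, enorm (S *m (w j - g)) <= 2 * K * 2^-1 ^+ j.
Proof.
move=> wK; have [|V wV VK] := @fast_cauchy_cvg _ _ (fun k => S *m w k) K.
  by move=> j; rewrite -mulmxBr.
(* The limit V of S w_k is S z for some z, so S V, the limit of S^2 w_k, is S^2 z: the equation for
   g is solvable, and its solution has S g = V. *)
have [z Vz] := range_closed wV.
have SSw i : (S *m S *m w k) i 0 @[k --> \oo] --> (S *m V) i 0.
  by under eq_cvg do rewrite -mulmxA; exact: mulmx_cvg.
exists (S *m V); split => //.
have [||g gW gcvg] := @tikhonov_cvg _ _ (S *m S) (S *m V) _ sym_sqr_ge0.
- by rewrite trmx_mul S_sym.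
- by exists z; rewrite Vz mulmxA.
exists g => //; split => // j.
by rewrite mulmxBr (_ : S *m g = V) //; rewrite Vz; apply/esym/sym_sqr_eq; rewrite gW Vz mulmxA.
Qed.
End fast_cauchy_seminorm.

(** * The functionals N_S and B_S over a measure space *)

Section energy.
Context d (T : measurableType d) (R : realType).
Variables (mu : {measure set T -> \bar R}) (E : set T) (mE : measurable E).
Variables (p : R) (p1 : 1 < p) (m : nat) (S : T -> 'M[R]_m).
Hypothesis S_sym : forall x, E x -> (S x)^T = S x.
Hypothesis mSS : mx_measurable E (fun x => S x *m S x).

Let p0 : 0 < p. Proof. exact: lt_trans p1. Qed.
Let pm1 : 0 < p - 1. Proof. by rewrite subr_gt0. Qed.

Implicit Types g h : T -> 'cV[R]_m.

Definition pnorm g x : R := enorm (S x *m g x).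

(** This is 1/p times the derivative of |S g|^p in the direction h. The product S S, in place of an
    inner product of S h and S g, keeps the expression measurable and becomes Q in the weak
    equation. *)
Definition pinner g h x : R :=
  pnorm g x `^ (p - 2) * ((h x)^T *m (S x *m S x) *m g x) 0 0.

Definition in_L g := mx_measurable E g /\
  mu.-integrable E (fun x => (pnorm g x `^ p)%:E).

Definition energy g : R := (\int[mu]_(x in E) (pnorm g x `^ p))%R.

Definition pairing g h : R := (\int[mu]_(x in E) pinner g h x)%R.

Lemma pnorm_ge0 g x : 0 <= pnorm g x. Proof. exact: enorm_ge0. Qed.

Lemma quadraticE g h x : E x ->
  ((h x)^T *m (S x *m S x) *m g x) 0 0 = dot (S x *m h x) (S x *m g x).
Proof.
by move=> Ex; rewrite dotE trmx_mul S_sym// !mulmxA.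
Qed.

Lemma pinnerE g h x : E x ->
  pinner g h x = pnorm g x `^ (p - 2) * dot (S x *m h x) (S x *m g x).
Proof. by move=> Ex; rewrite /pinner quadraticE. Qed.

Lemma pinner_le g h x : E x ->
  `|pinner g h x| <= pnorm g x `^ (p - 1) * pnorm h x.
Proof.
move=> Ex; rewrite pinnerE// normrM ger0_norm ?powR_ge0//.
rewrite -[p - 1 in leRHS](_ : p - 2 + 1 = _); last by ring.
have [g0|g0] := eqVneq (pnorm g x) 0.
  rewrite [S x *m g x](enorm_eq0 g0) /dot big1 ?normr0 ?mulr0.
    by rewrite mulr_ge0 ?powR_ge0 ?pnorm_ge0.
  by move=> i _; rewrite [X in _ * X]mxE mulr0.
rewrite [in leRHS]powRD ?g0 ?implybT// powRr1 ?pnorm_ge0// -mulrA ler_wpM2l ?powR_ge0//.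
by rewrite mulrC; exact: normr_dot_le.
Qed.

Lemma pinnerxx g x : E x -> pinner g g x = pnorm g x `^ p.
Proof.
move=> Ex; rewrite pinnerE// -enorm_sqr -/(pnorm g x).
have [->|g0] := eqVneq (pnorm g x) 0.
  by rewrite expr0n mulr0 powR0// gt_eqF.
rewrite -powR_mulrn ?pnorm_ge0// -powRD ?g0 ?implybT//; congr (_ `^ _); ring.
Qed.

Lemma pinner_linear g h h' a x : pinner g (fun x => a *: h x + h' x) x =
  a * pinner g h x + pinner g h' x.
Proof.
rewrite /pinner (_ : (_ + _)^T = a *: (h x)^T + (h' x)^T).
  rewrite 2!mulmxDl -!scalemxAl [X in _ * X]mxE [X in _ * (X + _)]mxE.
  by rewrite mulrDr mulrCA.
by apply/matrixP => i j; rewrite !mxE.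
Qed.

Lemma measurable_quadratic g h : mx_measurable E g -> mx_measurable E h ->
  measurable_fun E (fun x => ((h x)^T *m (S x *m S x) *m g x) 0 0).
Proof.
move=> mg mh; apply: (mx_measurable_mul _ mg 0 0).
by apply: mx_measurable_mul => //; exact: mx_measurable_tr.
Qed.

(** Only S^2 is assumed measurable, so |S g| is obtained as the square root of g^t S^2 g. *)
Lemma measurable_pnorm g : mx_measurable E g -> measurable_fun E (pnorm g).
Proof.
move=> mg; apply: (@eq_measurable_fun _ _ _ _ E
  (fun x => ((g x)^T *m (S x *m S x) *m g x) 0 0 `^ 2^-1)).
  move=> x /[!inE] Ex; rewrite quadraticE// powR12_sqrt ?dot_ge0//.

apply: (measurableT_comp (f := @powR R ^~ 2^-1)); first exact: measurable_powR.
exact: measurable_quadratic.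
Qed.

Lemma measurable_pnorm_powR g q : mx_measurable E g ->
  measurable_fun E (fun x => pnorm g x `^ q).
Proof.
move=> mg; apply: (measurableT_comp (f := @powR R ^~ q)).
  exact: measurable_powR.
exact: measurable_pnorm.
Qed.

Lemma measurable_pinner g h : mx_measurable E g -> mx_measurable E h ->
  measurable_fun E (pinner g h).
Proof.
move=> mg mh; apply: measurable_funM; first exact: measurable_pnorm_powR.
exact: measurable_quadratic.
Qed.

Lemma integrable_dom (f F : T -> R) : measurable_fun E f ->
  mu.-integrable E (EFin \o F) -> (forall x, E x -> `|f x| <= F x) ->
  mu.-integrable E (EFin \o f).
Proof.
move=> mf iF fF; apply: (le_integrable mE _ _ iF); first exact/measurable_EFinP.
by move=> x Ex /=; rewrite lee_fin (le_trans (fF x Ex))// ler_norm.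
Qed.

Lemma integrable_lin (f g : T -> R) a b : mu.-integrable E (EFin \o f) ->
  mu.-integrable E (EFin \o g) ->
  mu.-integrable E (EFin \o (fun x => a * f x + b * g x)).
Proof.
move=> fi gi.
have := integrableD mE (integrableZl mE a fi) (integrableZl mE b gi).
by apply: eq_integrable.
Qed.

Lemma Rintegral_lin (f g : T -> R) a b : mu.-integrable E (EFin \o f) ->
  mu.-integrable E (EFin \o g) ->
  (\int[mu]_(x in E) (a * f x + b * g x) =
   a * \int[mu]_(x in E) f x + b * \int[mu]_(x in E) g x)%R.
Proof.
move=> fi gi; rewrite RintegralD//; first by rewrite !RintegralZl.
- by have := integrableZl mE a fi; apply: eq_integrable.
- by have := integrableZl mE b gi; apply: eq_integrable.
Qed.

Lemma in_L_integrable g : in_L g ->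
  mu.-integrable E (EFin \o (fun x => pnorm g x `^ p)).
Proof. by case. Qed.

Lemma pnormD_le g h x : pnorm (fun x => g x + h x) x <= pnorm g x + pnorm h x.
Proof. by rewrite /pnorm mulmxDr; exact: enormD. Qed.

Lemma pnormZ g a x : pnorm (fun x => a *: g x) x = `|a| * pnorm g x.
Proof. by rewrite /pnorm -scalemxAr enormZ. Qed.

Lemma in_LD g h : in_L g -> in_L h -> in_L (fun x => g x + h x).
Proof.
move=> gL hL; have mgh := mx_measurableD gL.1 hL.1; split => //.
apply: (integrable_dom (measurable_pnorm_powR p mgh)
  (integrable_lin (2 `^ p) (2 `^ p) gL.2 hL.2)) => x Ex.
rewrite ger0_norm ?powR_ge0//= -mulrDr.
apply: le_trans (powR_add_le p1 (pnorm_ge0 _ _) (pnorm_ge0 _ _)).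
by apply: (powR_le (ltW p0)); [exact: pnorm_ge0 | exact: pnormD_le].
Qed.

Lemma in_LZ g a : in_L g -> in_L (fun x => a *: g x).
Proof.
move=> gL; split; first exact: mx_measurableZ (measurable_cst _) gL.1.
have := integrableZl mE (`|a| `^ p) gL.2.
by apply: eq_integrable => // x _; rewrite pnormZ powRM ?pnorm_ge0// EFinM.
Qed.

Lemma in_LB g h : in_L g -> in_L h -> in_L (fun x => g x - h x).
Proof.
move=> gL hL; have := in_LD gL (in_LZ (-1) hL).
by under eq_fun do rewrite scaleN1r.
Qed.

Lemma energy_ge0 g : 0 <= energy g.
Proof. by apply: Rintegral_ge0 => x _; exact: powR_ge0. Qed.

Lemma energyE g : energy g = (\int[mu]_(x in E) (pnorm g x `^ p))%R.
Proof. by []. Qed.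

Lemma pairingE g h : pairing g h = (\int[mu]_(x in E) pinner g h x)%R.
Proof. by []. Qed.

Lemma energyZ g a : in_L g -> energy (fun x => a *: g x) = `|a| `^ p * energy g.
Proof.
move=> gL; rewrite /energy -RintegralZl//; last exact: gL.2.
by apply: eq_Rintegral => x _; rewrite pnormZ powRM ?pnorm_ge0.
Qed.

Lemma eq_energy g h : (forall x, E x -> g x = h x) -> energy g = energy h.
Proof.
by move=> gh; apply: eq_Rintegral => x; rewrite inE => Ex; rewrite /pnorm gh.
Qed.

Lemma energyD_le e g h : 0 < e -> in_L g -> in_L h ->
  energy (fun x => g x + h x) <=
  (1 + e) `^ p * energy g + (1 + e^-1) `^ p * energy h.
Proof.
move=> e0 gL hL; rewrite -Rintegral_lin; [|exact: gL.2|exact: hL.2].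
apply: le_Rintegral => //; first exact: (in_LD gL hL).2.
  exact: integrable_lin gL.2 hL.2.
move=> x Ex; apply: le_trans (powR_addl_le p1 e0 (pnorm_ge0 _ _) (pnorm_ge0 _ _)).
by apply: (powR_le (ltW p0)); [exact: pnorm_ge0 | exact: pnormD_le].
Qed.

Lemma integrable_pinner g h : in_L g -> in_L h ->
  mu.-integrable E (EFin \o pinner g h).
Proof.
move=> gL hL; apply: (integrable_dom (measurable_pinner gL.1 hL.1)
  (integrable_lin 1 (1 `^ (1 - p)) gL.2 hL.2)) => x Ex.
apply: le_trans (pinner_le _ _ Ex) _.
exact: (young_eps p1 ltr01 (pnorm_ge0 _ _) (pnorm_ge0 _ _)).
Qed.

Lemma pairing_linear g h h' a : in_L g -> in_L h -> in_L h' ->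
  pairing g (fun x => a *: h x + h' x) = a * pairing g h + pairing g h'.
Proof.
move=> gL hL h'L; rewrite -[pairing g h' in RHS]mul1r -Rintegral_lin.
- by apply: eq_Rintegral => x _; rewrite pinner_linear mul1r.
- exact: integrable_pinner.
- exact: integrable_pinner.
Qed.

Lemma pairing_le e g h : 0 < e -> in_L g -> in_L h ->
  `|pairing g h| <= e * energy g + e `^ (1 - p) * energy h.
Proof.
move=> e0 gL hL; rewrite -Rintegral_lin; [|exact: gL.2|exact: hL.2].
apply: (le_trans (le_normr_Rintegral mE (integrable_pinner gL hL))).
apply: le_Rintegral => //.
- by have := integrable_norm (integrable_pinner gL hL); apply: eq_integrable.
- exact: integrable_lin gL.2 hL.2.
- move=> x Ex; apply: le_trans (pinner_le _ _ Ex) _.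
  exact: (young_eps p1 e0 (pnorm_ge0 _ _) (pnorm_ge0 _ _)).
Qed.

Lemma pairingxx g : pairing g g = energy g.
Proof. by apply: eq_Rintegral => x; rewrite inE; exact: pinnerxx. Qed.

Lemma energy_tangent g h : in_L g -> in_L h ->
  energy g + p * pairing g h <= energy (fun x => g x + h x).
Proof.
move=> gL hL; rewrite -[energy g]mul1r -Rintegral_lin; last first.
- exact: integrable_pinner.
- exact: gL.2.
apply: le_Rintegral => //.
- by apply: integrable_lin; [exact: gL.2 | exact: integrable_pinner].
- exact: (in_LD gL hL).2.
move=> x Ex.
apply: le_trans (powR_tangent p1 (pnorm_ge0 g x) (enorm_ge0 _)).
rewrite mul1r lerD2l -mulrA ler_pM2l// mulrBr powRB1 ?pnorm_ge0// -pinnerxx//.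
(* Cauchy-Schwarz is applied to g against g + h, which turns the pairing with h into |S g|^(p-1) (|S
   (g + h)| - |S g|), the linear term of the scalar tangent inequality. *)
have -> : pinner g h x = pinner g (fun x => 1 *: g x + h x) x - pinner g g x.
  by rewrite pinner_linear mul1r addrC addKr.
rewrite lerD2r (le_trans (ler_norm _))// (le_trans (pinner_le _ _ Ex))//.
by rewrite /pnorm scale1r.
Qed.

Lemma energy_unif_convex e : 0 < e -> exists2 C : R, 0 < C &
  forall g h, in_L g -> in_L h ->
  energy (fun x => 2^-1 *: (g x - h x)) <= e * (energy g + energy h) +
    C * (energy g + energy h - 2 * energy (fun x => 2^-1 *: (g x + h x))).
Proof.
move=> e0; have [C C0 HC] := powR_unif_convex p1 e0; exists C => // g h gL hL.
have dL := in_LZ 2^-1 (in_LB gL hL); have aL := in_LZ 2^-1 (in_LD gL hL).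
have sL := integrable_lin 1 1 gL.2 hL.2.
have -> : energy g + energy h =
    (\int[mu]_(x in E) (1 * pnorm g x `^ p + 1 * pnorm h x `^ p))%R.
  have EG := Rintegral_lin 1 1 (in_L_integrable gL) (in_L_integrable hL).
  rewrite -[energy g]mul1r -[energy h]mul1r.
  exact: esym EG.
set a := fun x => 2^-1 *: (g x + h x) in aL *.
set s := fun x => 1 * pnorm g x `^ p + 1 * pnorm h x `^ p in sL *.
have -> : (\int[mu]_(x in E) s x)%R - 2 * energy a =
    (\int[mu]_(x in E) (1 * s x + (- 2) * pnorm a x `^ p))%R.
  have EG := Rintegral_lin 1 (- 2) sL (in_L_integrable aL).
  rewrite -[X in X - _]mul1r -mulNr; exact: esym EG.
rewrite -(Rintegral_lin e C sL (integrable_lin 1 (- 2) sL aL.2)).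
apply: le_Rintegral => //; first exact: dL.2.
  exact: (integrable_lin e C sL (integrable_lin 1 (- 2) sL aL.2)).
move=> x Ex; rewrite /s !mul1r mulNr; apply: HC; rewrite ?pnorm_ge0//.
  by rewrite /a /pnorm -!scalemxAr mulmxDr mulmxBr enorm_parallelogram.
rewrite /a pnormZ ger0_norm// mulrC ler_pM2r//; exact: pnormD_le.
Qed.

(* Keeps unification from unfolding two different energies down to the integral. *)
Opaque energy pairing.

(** Young's inequality leaves bounds of this shape, with c(e) possibly unbounded as e tends to 0: e
    is fixed first, and k is taken large afterwards. *)
Lemma cvg0_of_eps (a D : nat -> R) (M : R) (c : R -> R) :
  (forall e, 0 < e -> forall k, `|a k| <= e * M + c e * D k) ->
  D k @[k --> \oo] --> 0 -> a k @[k --> \oo] --> 0.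
Proof.
move=> H D0; apply/cvgr0Pnorm_le => r r0.
pose e := r / (2 * (`|M| + 1)).
have M1 : 0 < `|M| + 1 by rewrite ltr_wpDl.
have e0 : 0 < e by rewrite divr_gt0// mulr_gt0.
have c1 : 0 < `|c e| + 1 by rewrite ltr_wpDl.
have eM : e * M <= r / 2.
  have -> : r / 2 = e * (`|M| + 1) by rewrite /e; field; rewrite gt_eqF.
  by rewrite ler_pM2l// (le_trans (ler_norm _))// lerDl.
have r'0 : 0 < r / (2 * (`|c e| + 1)) by rewrite divr_gt0 ?mulr_gt0.
move/cvgr0Pnorm_le : D0 => /(_ _ r'0); apply: filterS => k Dk.
apply: le_trans (H e e0 k) _.
have -> : r = r / 2 + r / 2 by field.
rewrite lerD// (le_trans (ler_norm _))// normrM.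
have -> : r / 2 = (`|c e| + 1) * (r / (2 * (`|c e| + 1))) by field; rewrite gt_eqF.
by rewrite ler_pM// lerDl.
Qed.

Lemma energyD_le2 g h : in_L g -> in_L h ->
  energy (fun x => g x + h x) <= 2 `^ p * (energy g + energy h).
Proof.
by move=> gL hL; have := energyD_le ltr01 gL hL; rewrite invr1 mulrDr.
Qed.

Lemma energyBC g h : energy (fun x => g x - h x) = energy (fun x => h x - g x).
Proof.
by rewrite !energyE; apply: eq_Rintegral => x _; rewrite /pnorm -opprB mulmxN enormN.
Qed.

(** The tangent inequalities at g and at u_k enclose N(u_k) - N(g) between two pairings with the
    difference, each small by Young's inequality. This stands in for the reverse triangle
    inequality. *)
Lemma energy_cvg (u : nat -> T -> 'cV[R]_m) g :
  (forall k, in_L (u k)) -> in_L g ->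
  energy (fun x => u k x - g x) @[k --> \oo] --> 0 ->
  energy (u k) @[k --> \oo] --> energy g.
Proof.
move=> uL gL ug; apply/subr_cvg0.
pose D k := energy (fun x => u k x - g x).
apply: (@cvg0_of_eps _ D (p * (2 `^ p * energy g + energy g))
  (fun e => p * (e * 2 `^ p + e `^ (1 - p)))) => // e e0 k.
have dL := in_LB (uL k) gL; have dL' := in_LB gL (uL k).
have D0 : 0 <= D k by exact: energy_ge0.
have ub : energy (u k) <= 2 `^ p * (energy g + D k).
  rewrite (@eq_energy (u k) (fun x => g x + (u k x - g x))); last by move=> x _; rewrite subrKC.
  exact: energyD_le2.
have H1 : energy g + p * pairing g (fun x => u k x - g x) <= energy (u k).
  rewrite [leRHS](@eq_energy _ (fun x => g x + (u k x - g x))); last by move=> x _; rewrite subrKC.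
  exact: (energy_tangent gL dL).
have H2 : energy (u k) + p * pairing (u k) (fun x => g x - u k x) <= energy g.
  rewrite [leRHS](@eq_energy _ (fun x => u k x + (g x - u k x))); last by move=> x _; rewrite subrKC.
  exact: (energy_tangent (uL k) dL').
have /ler_normlP[P1 _] := pairing_le e0 gL dL.
have /ler_normlP[P2 _] := pairing_le e0 (uL k) dL'.
rewrite energyBC -/(D k) in P2; rewrite -/(D k) in P1.
have E0 := energy_ge0 g.
have t0 : 0 <= 2 `^ p :> R by exact: powR_ge0.
have q0 : 0 <= e `^ (1 - p) by exact: powR_ge0.
have P2' : - (p * pairing (u k) (fun x => g x - u k x)) <=
    p * (e * (2 `^ p * (energy g + D k)) + e `^ (1 - p) * D k).
  rewrite -mulrN ler_pM2l// (le_trans P2)// lerD2r ler_pM2l//.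
have P1' : - (p * pairing g (fun x => u k x - g x)) <=
    p * (e * energy g + e `^ (1 - p) * D k).
  by rewrite -mulrN ler_pM2l.
have N1 : 0 <= p * (e * (2 `^ p * (energy g + D k))).
  exact: mulr_ge0 (ltW p0) (mulr_ge0 (ltW e0) (mulr_ge0 t0 (addr_ge0 E0 D0))).
have N2 : 0 <= p * (e * energy g).
  exact: mulr_ge0 (ltW p0) (mulr_ge0 (ltW e0) E0).
move: H1 H2 P1' P2' N1 N2 {P1 P2 ub}.
move: (pairing g _) (pairing (u k) _) (energy g) (energy (u k)) (D k) D0 E0.
move=> P1 P2 X Y Z Z0 X0 H1 H2 P1' P2' N1 N2.
rewrite ler_norml; apply/andP; split; lra.
Qed.

Lemma pairingB g h h' : in_L g -> in_L h -> in_L h' ->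
  pairing g (fun x => h x - h' x) = pairing g h - pairing g h'.
Proof.
move=> gL hL h'L; have := pairing_linear (-1) gL h'L hL.
rewrite mulN1r addrC => <-; congr pairing; apply/funext => x.
by rewrite scaleN1r addrC.
Qed.

Lemma pairing_cvg h (u : nat -> T -> 'cV[R]_m) g :
  in_L h -> (forall k, in_L (u k)) -> in_L g ->
  energy (fun x => u k x - g x) @[k --> \oo] --> 0 ->
  pairing h (u k) @[k --> \oo] --> pairing h g.
Proof.
move=> hL uL gL ug; apply/subr_cvg0.
apply: (cvg0_of_eps (M := energy h) (c := fun e => e `^ (1 - p)) _ ug) => e e0 k.
rewrite -(pairingB hL (uL k) gL); exact: (pairing_le e0 hL (in_LB (uL k) gL)).
Qed.

Lemma pairingZ g h a : in_L g -> in_L h ->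
  pairing g (fun x => a *: h x) = a * pairing g h.
Proof.
move=> gL hL; rewrite !pairingE -RintegralZl//; last exact: integrable_pinner.
apply: eq_Rintegral => x _; rewrite /pinner linearZ/= -!scalemxAl [X in _ * X]mxE.
by rewrite mulrCA.
Qed.

Lemma powR_cvg0_seq (a : nat -> R) (q : R) : 0 < q -> (forall k, 0 <= a k) ->
  a k @[k --> \oo] --> 0 -> a k `^ q @[k --> \oo] --> (0 : R).
Proof.
move=> q0 a0 /cvgr0Pnorm_le ac; apply/cvgr0Pnorm_le => r r0.
have rq : 0 < r `^ q^-1 by rewrite powR_gt0.
move/(_ _ rq) : ac; apply: filterS => k.
rewrite !ger0_norm ?powR_ge0// => Hk.
have -> : r = (r `^ q^-1) `^ q by rewrite -powRrM mulVf ?gt_eqF// powRr1// ltW.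
exact: powR_le (ltW q0) _ Hk.
Qed.

Lemma pinner_cvg g h x : E x ->
  pinner (fun x => g x + k.+1%:R^-1 *: h x) h x @[k --> \oo] --> pinner g h x.
Proof.
move=> Ex; pose t k : R := k.+1%:R^-1; pose G k y := g y + t k *: h y.
have t0 k : 0 <= t k by rewrite invr_ge0.
have tc : t k @[k --> \oo] --> 0 by exact: cvg_harmonic.
have GS k : S x *m G k x = S x *m g x + t k *: (S x *m h x).
  by rewrite mulmxDr -scalemxAr.
(* Where S g = 0 the factor |S g|^(p-2) is singular for p < 2, but with t = 1/(k+1) the whole
   expression is at most t^(p-1) |S h|^p. Elsewhere each factor is continuous. *)
have [g0|g0] := eqVneq (pnorm g x) 0.
  have Sg0 : S x *m g x = 0 by exact: enorm_eq0.
  have -> : pinner g h x = 0.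
    rewrite (pinnerE _ _ Ex) Sg0 /dot big1 ?mulr0// => i _.
    by rewrite [X in _ * X]mxE mulr0.
  apply: (cvg_dist_le (a := fun k => k.+1%:R^-1 `^ (p - 1) * pnorm h x `^ p)).
    move=> k; rewrite subr0; apply: le_trans (pinner_le _ _ Ex) _.
    rewrite -(powRB1 p1 (pnorm_ge0 h x)) mulrA ler_wpM2r ?pnorm_ge0//.
    rewrite -powRM ?pnorm_ge0// /pnorm (GS k) Sg0 add0r enormZ ger0_norm//.
  rewrite -[X in _ --> X](mul0r (pnorm h x `^ p)); apply: cvgMr_tmp.
  apply: powR_cvg0_seq => //; exact: t0.
have gp : 0 < pnorm g x by rewrite lt0r g0 pnorm_ge0.
rewrite (pinnerE _ _ Ex); under eq_cvg do rewrite (pinnerE _ _ Ex).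
apply: cvgM.
  have pc : {for pnorm g x, continuous (@powR R ^~ (p - 2))}.
    apply: differentiable_continuous; apply/derivable1_diffP.
    by apply: derivable_powR; rewrite in_itv/= gp.
  suff H : pnorm (G k) x @[k --> \oo] --> pnorm g x by exact: (cvg_comp _ _ H pc).
  apply: (cvg_dist_le (a := fun k => t k * pnorm h x)).
    move=> k; apply: le_trans (enorm_dist _ _) _.
    by rewrite (GS k) addrC addKr enormZ ger0_norm.
  by rewrite -[X in _ --> X](mul0r (pnorm h x)); apply: cvgMr_tmp.
apply: (cvg_dist_le (a := fun k => t k * `|dot (S x *m h x) (S x *m h x)|)).
  move=> k; rewrite [X in `|dot _ X - _|](GS k) dotDr dotZr addrC addKr normrM.
  by rewrite ger0_norm.
rewrite -[X in _ --> X](mul0r `|dot (S x *m h x) (S x *m h x)|); exact: cvgMr_tmp.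
Qed.

Lemma pairing_gateaux g h : in_L g -> in_L h ->
  pairing (fun x => g x + k.+1%:R^-1 *: h x) h @[k --> \oo] --> pairing g h.
Proof.
move=> gL hL; pose u k := fun x => g x + k.+1%:R^-1 *: h x.
have uL k : in_L (u k) by exact/in_LD/in_LZ.
pose F x := 2 `^ p * pnorm g x `^ p + (2 `^ p + 1) * pnorm h x `^ p.
have [|||||_ _ H] := @dominated_convergence _ T R mu E mE
    (fun k => EFin \o pinner (u k) h) (EFin \o pinner g h) (EFin \o F).
- by move=> k; apply/measurable_EFinP; apply: measurable_pinner; [exact: (uL k).1|exact: hL.1].
- by apply/measurable_EFinP; apply: measurable_pinner; [exact: gL.1|exact: hL.1].
- by apply: aeW => x Ex; apply: cvg_EFin; [exact: nearW | exact: pinner_cvg].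
- exact: integrable_lin gL.2 hL.2.
- apply: aeW => x k Ex /=; rewrite lee_fin.
  apply: le_trans (pinner_le _ _ Ex) _.
  apply: (le_trans (young_eps p1 ltr01 (pnorm_ge0 _ _) (pnorm_ge0 _ _))).
  rewrite mul1r powR1 mul1r /F mulrDl mul1r addrA lerD2r -mulrDr.
  apply: le_trans (powR_add_le p1 (pnorm_ge0 _ _) (pnorm_ge0 _ _)).
  apply: (powR_le (ltW p0)); first exact: pnorm_ge0.
  apply: le_trans (pnormD_le _ _ _) _; rewrite lerD2l pnormZ.
  by rewrite ger0_norm ?invr_ge0// ler_piMl ?pnorm_ge0// invf_le1// ler1n.
- under eq_cvg do rewrite pairingE; rewrite pairingE.
  apply: fine_cvg; rewrite fineK//.
  exact: integrable_fin_num (integrable_pinner gL hL).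
Qed.

(** For t > 0 and u = g + t h, the tangent inequality at u and minimality give N(u) - p t B(u, h) <=
    N(g) <= N(u) + p t c, so B(u, h) + c >= 0. Letting t tend to 0, and repeating with -h and -c,
    yields the equality. *)
Lemma energy_minimizer_pairing g h (c : R) : in_L g -> in_L h ->
  (forall t : R, energy g <= energy (fun x => g x + t *: h x) + p * (t * c)) ->
  pairing g h = - c.
Proof.
move=> gL hL gmin.
suff H : forall h c, in_L h ->
    (forall t : R, energy g <= energy (fun x => g x + t *: h x) + p * (t * c)) ->
    0 <= pairing g h + c.
  apply/eqP; rewrite -subr_eq0 opprK eq_le H// andbT.
  have := H _ (- c) (in_LZ (-1) hL).
  rewrite pairingZ// mulN1r -opprD oppr_ge0; apply => t.
  have := gmin (- t); rewrite mulNr -mulrN.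
  rewrite (@eq_energy (fun x => g x + - t *: h x) (fun x => g x + t *: (-1 *: h x)))//.
  by move=> x _; rewrite scalerA mulrN1.
move=> {gmin c hL}h c hL gmin.
have H : pairing (fun x => g x + k.+1%:R^-1 *: h x) h + c @[k --> \oo] --> pairing g h + c.
  by apply: cvgD; [exact: pairing_gateaux | exact: cvg_cst].
rewrite -(cvg_lim _ H)//; apply: limr_ge; first by apply/cvg_ex; eexists; exact: H.
apply: nearW => k; set t := _^-1; set u := (X in pairing X).
have t0 : 0 < t by rewrite invr_gt0.
have uL : in_L u by exact/in_LD/in_LZ.
have := energy_tangent uL (in_LZ (- t) hL).
rewrite (@eq_energy (fun x => u x + - t *: h x) g); last first.
  by move=> x _; rewrite /u scaleNr addrK.
have gt : energy g <= energy u + p * (t * c) by exact: gmin.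
rewrite (pairingZ _ uL hL) => H1; move: (le_trans H1 gt) => {H1 gt}.
rewrite -(pmulr_rge0 _ t0) -(pmulr_rge0 _ p0).
by move: (pairing u h) (energy u) => X Y; rewrite addrC -lerBlDr; nra.
Qed.

Lemma subseq_fast_cauchy (u : nat -> T -> 'cV[R]_m) (c : nat -> R) :
  (forall j, 0 < c j) ->
  (forall e, 0 < e -> exists N, forall k l, (N <= k)%N -> (N <= l)%N ->
     energy (fun x => u k x - u l x) <= e) ->
  exists s : nat -> nat, forall j k, (s j <= k)%N ->
    energy (fun x => u k x - u (s j) x) <= c j /\ (s j <= s j.+1)%N.
Proof.
move=> c0 Hu.
have [N HN] : {N : nat -> nat & forall j k l, (N j <= k)%N -> (N j <= l)%N ->
    energy (fun x => u k x - u l x) <= c j}.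
  by apply: (@choice _ _ (fun j N => forall k l, (N <= k)%N -> (N <= l)%N ->
    energy (fun x => u k x - u l x) <= c j)) => j; apply: Hu.
(* A running maximum makes s nondecreasing, so that s (j+1) is itself an admissible index beyond s
   j. *)
pose s j := (\max_(i < j.+1) N i)%N.
have Ns j : (N j <= s j)%N by exact: (leq_bigmax (@ord_max j)).
exists s => j k sk; split; first by apply: HN => //; exact: leq_trans (Ns j) sk.
by rewrite /s [leqRHS]big_ord_recr/= leq_maxl.
Qed.

Lemma energy_ae g h : mx_measurable E g -> mx_measurable E h ->
  {ae mu, forall x, E x -> g x = h x} -> energy g = energy h.
Proof.
move=> mg mh gh; rewrite !energyE /Rintegral.
have mpow k : mx_measurable E k -> measurable_fun E (fun x => (pnorm k x `^ p)%:E).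
  by move=> mk; apply/measurable_EFinP; exact: measurable_pnorm_powR.
rewrite (ae_eq_integral _ _ mE (mpow _ mg) (mpow _ mh))//.
by apply: filterS gh => x H Ex; rewrite /pnorm H.
Qed.

Lemma energy_complete (u : nat -> T -> 'cV[R]_m) :
  (forall k, in_L (u k)) ->
  (forall e, 0 < e -> exists N, forall k l, (N <= k)%N -> (N <= l)%N ->
     energy (fun x => u k x - u l x) <= e) ->
  exists2 g, in_L g & energy (fun x => u k x - g x) @[k --> \oo] --> 0.
Proof.
move=> uL Hu.
(* [F = \sum_j (2^j |S (w_(j+1) - w_j)|)^p] is integrable, so that a.e. the steps decay like [F^(1/p) 2^-j]. *)
pose b j : R := (2 ^+ j) `^ p.
have b0 j : 0 < b j by rewrite powR_gt0// exprn_gt0.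
(* The step energies, multiplied by the weights b j, then sum to at most 1, which bounds the
   integral of F. *)
pose c j : R := (b j)^-1 * (1 / (2 ^ j.+1)%:R).
have c0 j : 0 < c j by rewrite mulr_gt0 ?invr_gt0// divr_gt0// ltr0n expn_gt0.
have [s Hs] := subseq_fast_cauchy c0 Hu.
pose w j := u (s j).
have wL j : in_L (w j) by exact: uL.
pose f j x : R := b j * pnorm (fun x => w j.+1 x - w j x) x `^ p.
have dL j : in_L (fun x => w j.+1 x - w j x) by exact: in_LB.
have f0 j x : 0 <= f j x by rewrite mulr_ge0 ?powR_ge0// ltW.
have mf j : measurable_fun E (f j).
  apply: measurable_funM; first exact: measurable_cst.
  exact: measurable_pnorm_powR (dL j).1.
pose F x : \bar R := (\sum_(0 <= j <oo) (f j x)%:E)%E.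
have mF : measurable_fun E F.
  apply: ge0_emeasurable_sum; first by move=> k x _ _; rewrite lee_fin.
  by move=> k _; exact/measurable_EFinP.
have F0 x : (0 <= F x)%E by apply: nneseries_ge0 => k _ _; rewrite lee_fin.
have iF : mu.-integrable E F.
  apply/integrableP; split => //.
  rewrite (_ : (\int[mu]_(x in E) _)%E = (\int[mu]_(x in E) F x)%E); last first.
    by apply: eq_integral => x _; rewrite gee0_abs.
  rewrite integral_nneseries//; last 2 first.
  - by move=> k; exact/measurable_EFinP.
  - by move=> k x _; rewrite lee_fin.
  apply: (@le_lt_trans _ _ 1%:E); last by rewrite ltry.
  apply: le_trans (epsilon_trick0 xpredT (@ler01 R)).
  apply: lee_nneseries; first by move=> k _ _; apply: integral_ge0 => x _; rewrite lee_fin.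
  move=> k _; under eq_integral do rewrite EFinM.
  rewrite integralZl//; last exact: (dL k).2.
  have [H _] := Hs k (s k.+1) (Hs k (s k) (leqnn _)).2.
  rewrite energyE /Rintegral in H.
  rewrite -(@fineK _ (\int[mu]_(x in E) _)%E); last first.
    exact: integrable_fin_num (dL k).2.
  by rewrite -EFinM lee_fin -ler_pdivlMl.
have iFf : mu.-integrable E (EFin \o (fine \o F)).
  apply: (le_integrable mE _ _ iF).
    apply/measurable_EFinP; apply: (measurableT_comp (f := @fine R) (g := F)) => //.
  by move=> x Ex /=; case: (F x) => [a| |] /=; rewrite ?lexx ?normr0 ?leey.
(* Setting [w] to 0 off the full-measure set [G] makes everything converge at every point. *)
pose G := E `&` [set x | F x \is a fin_num].
have mG : measurable G by exact: emeasurable_fin_num.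
pose w' j x : 'cV[R]_m := \1_G x *: w j x.
have w'G j x : G x -> w' j x = w j x.
  by move=> Gx; rewrite /w' indicE mem_set// scale1r.
have w'NG j x : ~ G x -> w' j x = 0.
  by move=> Gx; rewrite /w' indicE memNset// scale0r.
have mw' j : mx_measurable E (w' j).
  by apply: mx_measurableZ (wL j).1; exact: measurable_indic.
pose K x := fine (F x) `^ p^-1.
have stepK x j : E x -> enorm (S x *m (w' j.+1 x - w' j x)) <= K x * 2^-1 ^+ j.
  move=> Ex; have [Gx|Gx] := pselect (G x); last first.
    by rewrite !w'NG// subrr mulmx0 enorm0 mulr_ge0 ?powR_ge0// exprn_ge0.
  rewrite !w'G// -/(pnorm (fun x => w j.+1 x - w j x) x).
  rewrite exprVn ler_pdivlMr ?exprn_gt0//.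
  have H : f j x <= fine (F x).
    rewrite -lee_fin fineK; last exact: Gx.2.
    apply: le_trans (@nneseries_lim_ge R (fun j => (f j x)%:E) xpredT 0%N j.+1 _); last first.
      by move=> k _ _; rewrite lee_fin.
    rewrite big_nat_recr//= leeDr//; apply: sume_ge0 => i _; by rewrite lee_fin.
  have -> : pnorm (fun x => w j.+1 x - w j x) x * 2 ^+ j = f j x `^ p^-1.
    rewrite /f /b mulrC -powRM ?exprn_ge0 ?pnorm_ge0// -powRrM mulfV ?gt_eqF// powRr1//.
    by rewrite mulr_ge0 ?exprn_ge0 ?pnorm_ge0.
  by apply: powR_le => //; rewrite invr_ge0 ltW.
(* Both W and g are written as limits of explicit measurable sequences; [HW] then identifies them,
   at each point of E, with the vectors obtained there by existence alone. *)
pose W x : 'cV[R]_m := \col_i limn (fun k => (S x *m S x *m w' k x) i 0).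
pose g x : 'cV[R]_m := \col_i limn (fun k => tikhonov (S x *m S x) (W x) k.+1%:R^-1 i 0).
have HW x : E x -> (forall i, (S x *m S x *m w' k x) i 0 @[k --> \oo] --> W x i 0) /\
    (forall i, tikhonov (S x *m S x) (W x) k.+1%:R^-1 i 0 @[k --> \oo] --> g x i 0) /\
    (forall j, enorm (S x *m (w' j x - g x)) <= 2 * K x * 2^-1 ^+ j).
  move=> Ex; have [W0 [W0c [g0 W0g [g0c Hg]]]] := fast_cauchy_seminorm (S_sym Ex) (fun j => stepK x j Ex).
  have WE : W x = W0.
    by apply/matrixP => i j; rewrite ord1 mxE; apply/cvg_lim => //; exact: W0c.
  have gE : g x = g0.
    apply/matrixP => i j; rewrite ord1 mxE; apply/cvg_lim => //.
    by rewrite WE; exact: g0c.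
  by rewrite WE gE.
have mW : mx_measurable E W.
  move=> i j; rewrite ord1.
  apply: (@measurable_fun_cvg _ _ _ _ (fun k x => (S x *m S x *m w' k x) i 0)).
    by move=> k; exact: mx_measurable_mul.
  by move=> x Ex; exact: (HW x Ex).1.
have mg : mx_measurable E g.
  move=> i j; rewrite ord1.
  apply: (@measurable_fun_cvg _ _ _ _ (fun k x => tikhonov (S x *m S x) (W x) k.+1%:R^-1 i 0)).
    move=> k; rewrite /tikhonov.
    have mA : mx_measurable E (fun x => S x *m S x + (k.+1%:R^-1)%:M).
      by apply: mx_measurableD => //; exact: mx_measurable_cst.
    apply: mx_measurableZ; first exact/measurable_inv/measurable_det.
    by apply: mx_measurable_mul => //; exact: mx_measurable_adj.
  by move=> x Ex; exact: (HW x Ex).2.1.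
have md j : mx_measurable E (fun x => w' j x - g x).
  have := mx_measurableD (mw' j) (mx_measurableZ (measurable_cst (-1 : R)) mg).
  by under eq_fun do rewrite scaleN1r.
have bd j x : E x -> pnorm (fun x => w' j x - g x) x `^ p <= (2 * 2^-1 ^+ j) `^ p * fine (F x).
  move=> Ex; have Fx0 : 0 <= fine (F x) by exact: fine_ge0.
  have -> : fine (F x) = K x `^ p by rewrite -powRrM mulVf ?gt_eqF// powRr1.
  rewrite -powRM ?powR_ge0 ?mulr_ge0 ?exprn_ge0//.
  apply: (powR_le (ltW p0)); first exact: pnorm_ge0.
  by rewrite mulrAC; exact: (HW x Ex).2.2.
have iF2 a : mu.-integrable E (EFin \o (fun x => a * fine (F x))).
  by have := integrableZl mE a iFf; apply: eq_integrable.
have dgL j : in_L (fun x => w' j x - g x).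
  split => //; apply: (integrable_dom (measurable_pnorm_powR _ (md j)) (iF2 ((2 * 2^-1 ^+ j) `^ p))) => x Ex.
  by rewrite ger0_norm ?powR_ge0//; exact: bd.
have w'L j : in_L (w' j).
  split => //; apply: (integrable_dom (measurable_pnorm_powR _ (mw' j)) (wL j).2) => x Ex.
  rewrite (ger0_norm (powR_ge0 _ _)); apply: (powR_le (ltW p0)); first exact: pnorm_ge0.
  rewrite /pnorm; have [Gx|Gx] := pselect (G x); first by rewrite w'G.
  by rewrite w'NG// mulmx0 enorm0 enorm_ge0.
have gL : in_L g.
  have := in_LB (w'L 0%N) (dgL 0%N); under eq_fun do rewrite subKr; exact.
exists g => //.
have Ew j : energy (fun x => w j x - g x) = energy (fun x => w' j x - g x).
  apply: energy_ae; [exact: (in_LB (wL j) gL).1 | exact: md |].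
  have := integrable_ae mE iF; apply: filterS => x H Ex.
  by rewrite w'G//; split => //; exact: H.
pose I := (\int[mu]_(x in E) fine (F x))%R.
have I0 : 0 <= I by apply: Rintegral_ge0 => x _; exact: fine_ge0.
pose h j : R := 2^-1 ^+ j.
have h0 j : 0 < h j by rewrite exprn_gt0.
have h1 j : h j <= 1 by rewrite exprn_ile1//; lra.
have Eb j : energy (fun x => w j x - g x) <= 2 `^ p * I * h j.
  rewrite Ew; apply: (@le_trans _ _ ((2 * h j) `^ p * I)).
    rewrite /I -RintegralZl// energyE; apply: le_Rintegral => //; first exact: (dgL j).2.
    exact: bd.
  rewrite powRM ?(ltW (h0 j))// mulrAC ler_wpM2l ?mulr_ge0 ?powR_ge0//.
  by apply: ge1r_powR; rewrite ?h0 ?h1 ?ltW.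
have cb j : c j <= h j.
  have b1 : 1 <= b j.
    have -> : 1 = 1 `^ p :> R by rewrite powR1.
    by apply: powR_le; rewrite ?(ltW p0)// exprn_ege1// ler1n.
  have H2 : 1 / (2 ^ j.+1)%:R = 2^-1 * h j by rewrite /h natrX exprS div1r invfM exprVn.
  rewrite /c H2 mulrA ler_piMl ?(ltW (h0 j))// mulr_ile1 ?invr_ge0 ?(ltW (b0 j))//.
    by rewrite invf_le1.
  by rewrite invf_le1// ler1n.
pose M := 2 `^ p * (1 + 2 `^ p * I).
have M0 : 0 <= M by rewrite mulr_ge0 ?powR_ge0// addr_ge0// mulr_ge0 ?powR_ge0.
(* Every u_k beyond s j has energy distance at most c j from w j, so the rate of the subsequence
   carries over to the whole sequence. *)
have tot j k : (s j <= k)%N -> energy (fun x => u k x - g x) <= M * h j.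
  move=> sk; have [H _] := Hs j k sk.
  rewrite (@eq_energy _ (fun x => (u k x - w j x) + (w j x - g x))); last first.
    by move=> x _; rewrite addrA subrK.
  apply: le_trans (energyD_le2 (in_LB (uL k) (wL j)) (in_LB (wL j) gL)) _.
  rewrite /M -mulrA ler_wpM2l ?powR_ge0// mulrDl mul1r.
  by apply: lerD (Eb j); exact: le_trans H (cb j).
apply/cvgr0Pnorm_le => r r0.
have hM : M * h j @[j --> \oo] --> 0.
  rewrite -[X in _ --> X](mulr0 M); apply: cvgMl_tmp.
  have := @cvg_geometric R 1 2^-1; rewrite ger0_norm// invf_lt1// ltr1n => /(_ isT).
  by apply: cvg_trans; apply: near_eq_cvg; apply: nearW => j; rewrite /geometric/= mul1r.
move/cvgr0Pnorm_le : hM => /(_ _ r0)[j _ Hj].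
exists (s j) => // k /= sk; rewrite ger0_norm ?energy_ge0//.
apply: le_trans (tot j k sk) _; apply: le_trans (Hj j _) => //=.
exact: ler_norm.
Qed.
End energy.

(** * Lebesgue measurability of open sets *)

Section lebesgue_open.
Variables (R : realType) (n : nat).
Local Notation V := 'rV[R]_n.+1.
Local Notation T := (lebesgue_space R n).

(** The box is cut along x_i = c. Truncation by [Num.max 0] keeps additivity when a piece is
    empty. *)
Lemma box_vol_split (ab : V * V) (i : 'I_n.+1) (c : R) :
  box_vol ab =
    box_vol (ab.1, \row_j (if j == i then Num.min (ab.2 0 j) c else ab.2 0 j)) +
    box_vol (\row_j (if j == i then Num.max (ab.1 0 j) c else ab.1 0 j), ab.2).
Proof.
case: ab => a b; rewrite /box_vol /= !(bigD1 i (P := xpredT))//= !mxE eqxx.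
have -> : \prod_(j < n.+1 | j != i) Num.max 0
    ((\row_j (if j == i then Num.min (b 0 j) c else b 0 j)) 0 j - a 0 j) =
    \prod_(j < n.+1 | j != i) Num.max 0 (b 0 j - a 0 j).
  by apply: eq_bigr => j /negbTE ji; rewrite mxE ji.
have -> : \prod_(j < n.+1 | j != i) Num.max 0
    (b 0 j - (\row_j (if j == i then Num.max (a 0 j) c else a 0 j)) 0 j) =
    \prod_(j < n.+1 | j != i) Num.max 0 (b 0 j - a 0 j).
  by apply: eq_bigr => j /negbTE ji; rewrite mxE ji.
rewrite -mulrDl; congr (_ * _).
move: (a 0 i) (b 0 i) => x y.
rewrite !maxEle !minEle.
by case: (leP y c) => ?; case: (leP x c) => ?; repeat (case: leP => ?); lra.
Qed.

(** Cutting every box of a cover of X along the hyperplane gives covers of the two parts of X with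
    the same total volume, which is the Caratheodory criterion. *)
Lemma halfspace_measurable (i : 'I_n.+1) (c : R) :
  measurable ([set x : V | x 0 i <= c] : set T).
Proof.
apply: le_caratheodory_measurable => X.
apply: le_ereal_inf_tmp => _ [ab Xab <-].
pose ab1 k := ((ab k).1, \row_j (if j == i then Num.min ((ab k).2 0 j) c else (ab k).2 0 j)).
pose ab2 k := (\row_j (if j == i then Num.max ((ab k).1 0 j) c else (ab k).1 0 j), (ab k).2).
have -> : (\sum_(k <oo) (box_vol (ab k))%:E =
  \sum_(k <oo) (box_vol (ab1 k))%:E + \sum_(k <oo) (box_vol (ab2 k))%:E)%E.
  rewrite -nneseriesD; last 2 first.
  - by move=> k _ _; rewrite lee_fin box_vol_ge0.
  - by move=> k _ _; rewrite lee_fin box_vol_ge0.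
  by apply: eq_eseriesr => k _; rewrite (box_vol_split _ i c) EFinD.
apply: leeD; apply: ereal_inf_lbound; [exists ab1|exists ab2] => // x [Xx xc].
  have [k _ kx] := Xab x Xx; exists k => // j; rewrite /ab1/= mxE.
  have := kx j; case: eqP => // -> /andP[-> xb] /=; rewrite le_min xb; exact: xc.
have [k _ kx] := Xab x Xx; exists k => // j; rewrite /ab2/= mxE.
have := kx j; case: eqP => // -> /andP[ax ->]; rewrite andbT gt_max ax/= ltNge.
exact/negP.
Qed.

Lemma open_lebesgue_measurable (U : set V) : open U -> measurable (U : set T).
Proof.
move=> oU.
have slab i (a b : R) : measurable ([set x : V | a < x 0 i <= b] : set T).
  rewrite (_ : [set _ | _] = [set x : V | x 0 i <= b] `\` [set x : V | x 0 i <= a]).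
    by apply: measurableD; exact: halfspace_measurable.
  apply/seteqP; split => x /=.
    by move=> /andP[ax xb]; split => //; apply/negP; rewrite -ltNge.
  by move=> [xb /negP]; rewrite -ltNge => ax; rewrite ax.
(* A countable family: rational centre q.1 and half-width 1/(q.2 + 1). A box that contains x and has
   half-width below e/2 lies in the e-ball around x. *)
pose B (q : 'rV[rat]_n.+1 * nat) : set V := [set x | forall i,
  ratr (q.1 0 i) - q.2.+1%:R^-1 < x 0 i <= ratr (q.1 0 i) + q.2.+1%:R^-1].
have mB q : measurable (B q : set T).
  rewrite (_ : B q = \bigcap_(i in [set: 'I_n.+1]) [set x : V |
      ratr (q.1 0 i) - q.2.+1%:R^-1 < x 0 i <= ratr (q.1 0 i) + q.2.+1%:R^-1]).
    by apply: (@fin_bigcap_measurable _ T) => // i _; exact: slab.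
  by apply/seteqP; split => x Bx i => [_|]; exact: (Bx i).
have aux (r t s z d : R) : t < d / 2 -> r - t < z -> z <= r + t ->
    s - t < r -> r < s + t -> `|s - z| < d.
  by move=> *; rewrite ltr_norml; apply/andP; split; lra.
have aux2 (r t s : R) : s - t < r -> r < s + t -> r - t < s <= r + t.
  by move=> *; apply/andP; split; lra.
have UE : U = \bigcup_(q in [set q | B q `<=` U]) B q.
  apply/seteqP; split => x; last by move=> [q /= BU Bx]; exact: BU.
  move=> Ux; have /nbhs_ballP[e /= e0 eU] := open_nbhs_nbhs (conj oU Ux).
  have [k ke] : exists k : nat, k.+1%:R^-1 < e / 2.
    have : 0 < e / 2 by rewrite divr_gt0.
    move=> /(@ltr_add_invr R _ _)/= [k]; rewrite add0r; by exists k.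
  have kp : 0 < k.+1%:R^-1 :> R by rewrite invr_gt0.
  have Hq i : exists q : rat, x 0 i - k.+1%:R^-1 < ratr q < x 0 i + k.+1%:R^-1.
    have /rat_in_itvoo[q] : x 0 i - k.+1%:R^-1 < x 0 i + k.+1%:R^-1 by rewrite ltrD2l gtrN.
    by rewrite in_itv/= => Hq; exists q.
  have [q Hqq] := choice Hq.
  have Eq i : (\row_j q j) 0 i = q i by rewrite mxE.
  exists (\row_j q j, k) => /=.
    move=> y By; apply: eU; split => // i j; rewrite ord1 /ball/=.
    have := By j; rewrite /= Eq => /andP[B1 B2]; have /andP[C1 C2] := Hqq j.
    exact: (aux _ _ _ _ _ ke B1 B2 C1 C2).
  by move=> i; rewrite /= Eq; have /andP[C1 C2] := Hqq i; exact: (aux2 _ _ _ C1 C2).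
rewrite UE bigcup_mkcond; apply: (@countable_bigcupT_measurable _ T).
  exact: countableP.
by move=> q; case: ifP => // _; exact: measurable0.
Qed.

End lebesgue_open.

Opaque energy pairing.

Lemma cvg_ext (R : realType) (a b : nat -> R) (l : R) :
  (forall k, a k = b k) -> b k @[k --> \oo] --> l -> a k @[k --> \oo] --> l.
Proof. by move=> ab; have -> : a = b by exact/funext. Qed.

Lemma cvg_le_lim (R : realType) (a b : nat -> R) (s t : R) :
  a k @[k --> \oo] --> s -> b k @[k --> \oo] --> t -> (forall k, a k <= b k) ->
  s <= t.
Proof.
move=> as_ bt ab; rewrite -(cvg_lim _ as_)// -(cvg_lim _ bt)//.
apply: ler_lim; [by apply/cvg_ex; exists s|by apply/cvg_ex; exists t|].
exact: nearW.
Qed.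

Lemma cvg0_combination (R : realType) (a b : nat -> R) (s t : R) :
  a k @[k --> \oo] --> 0 -> b k @[k --> \oo] --> 0 ->
  s * (a k * t + b k) @[k --> \oo] --> 0.
Proof.
move=> a0 b0; rewrite -[X in _ --> X](mulr0 s); apply: cvgMl_tmp.
rewrite -[X in _ --> X]addr0; apply: cvgD => //.
by rewrite -[X in _ --> X](mul0r t); exact: cvgMr_tmp.
Qed.

Lemma powR_two_half (R : realType) (p : R) : 2 `^ p * `|2^-1| `^ p = 1 :> R.
Proof. by rewrite ger0_norm// -powRM// mulfV// powR1. Qed.

(** * The Neumann and Poincare properties over a measure space *)

Section abstract_neumann_poincare.
Context d (T : measurableType d) (R : realType).
Variables (mu : {measure set T -> \bar R}) (E : set T) (mE : measurable E).
Variables (p : R) (p1 : 1 < p) (m : nat).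
Variables (SV : T -> 'M[R]_1) (SQ : T -> 'M[R]_m).
Hypothesis SV_sym : forall x, E x -> (SV x)^T = SV x.
Hypothesis SQ_sym : forall x, E x -> (SQ x)^T = SQ x.
Hypothesis mSV : mx_measurable E (fun x => SV x *m SV x).
Hypothesis mSQ : mx_measurable E (fun x => SQ x *m SQ x).

Definition lift (f : T -> R) (x : T) : 'cV[R]_1 := const_mx (f x).

Local Notation LV f := (in_L mu E p SV (lift f)).
Local Notation LQ g := (in_L mu E p SQ g).
Local Notation NV f := (energy mu E p SV (lift f)).
Local Notation NQ g := (energy mu E p SQ g).
Local Notation BV f h := (pairing mu E p SV (lift f) (lift h)).
Local Notation BQ g h := (pairing mu E p SQ g h).
Local Notation one := (fun _ : T => 1 : R).

Variables (D : (T -> R) -> Prop) (gr : (T -> R) -> T -> 'cV[R]_m).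
Hypothesis D_LV : forall f, D f -> LV f.
Hypothesis D_LQ : forall f, D f -> LQ (gr f).
Hypothesis D_lin : forall a f g, D f -> D g -> D (fun x => a * f x + g x).
Hypothesis gr_lin : forall a f g, D f -> D g ->
  forall x, E x -> gr (fun x => a * f x + g x) x = a *: gr f x + gr g x.
Hypothesis D_one : D one.
Hypothesis gr_one : forall x, E x -> gr one x = 0.
Hypothesis NV_one : 0 < NV one.

Definition in_space (u : T -> R) (g : T -> 'cV[R]_m) : Prop :=
  [/\ LV u, LQ g & exists f : nat -> T -> R,
    [/\ forall k, D (f k),
        NV (fun x => f k x - u x) @[k --> \oo] --> 0 &
        NQ (fun x => gr (f k) x - g x) @[k --> \oo] --> 0]].

(** For SV = v^(1/p), [BV one u] is the integral of u v. Writing mean zero as a pairing lets the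
    continuity of pairings carry it to limits. *)
Definition abstract_weak_solution (f u : T -> R) (g : T -> 'cV[R]_m) : Prop :=
  [/\ in_space u g, BV one u = 0 &
    forall phi, D phi -> BV one phi = 0 -> BQ g (gr phi) = - BV f phi].

Let p0 : 0 < p. Proof. exact: lt_trans p1. Qed.

Lemma liftD a f h :
  lift (fun x => a * f x + h x) = fun x => a *: lift f x + lift h x.
Proof. by apply/funext => x; apply/matrixP => i j; rewrite !mxE. Qed.

Lemma liftB f h : lift (fun x => f x - h x) = fun x => lift f x - lift h x.
Proof. by apply/funext => x; apply/matrixP => i j; rewrite !mxE. Qed.

Lemma NV_cvg_lift (f : nat -> T -> R) u :
  NV (fun x => f k x - u x) @[k --> \oo] --> 0 ->
  energy mu E p SV (fun x => lift (f k) x - lift u x) @[k --> \oo] --> 0.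
Proof.
have H k : energy mu E p SV (fun x => lift (f k) x - lift u x) =
    NV (fun x => f k x - u x) by rewrite (liftB (f k) u).
by move=> Hc; exact: (cvg_ext H Hc).
Qed.

Lemma lift_coord (U : T -> 'cV[R]_1) : lift (fun x => U x 0 0) = U.
Proof. by apply/funext => x; apply/matrixP => i j; rewrite !ord1 mxE. Qed.

Lemma BV_lin a f h h' : LV f -> LV h -> LV h' ->
  BV f (fun x => a * h x + h' x) = a * BV f h + BV f h'.
Proof. by move=> fL hL h'L; rewrite liftD; exact: (pairing_linear mE p1 SV_sym mSV). Qed.

(* Subtracting the mean value turns an approximating sequence into one of mean zero. *)
Lemma in_space_approx u g : in_space u g -> BV one u = 0 ->
  exists f : nat -> T -> R,
    [/\ forall k, D (f k), forall k, BV one (f k) = 0,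
        NV (fun x => f k x - u x) @[k --> \oo] --> 0 &
        NQ (fun x => gr (f k) x - g x) @[k --> \oo] --> 0].
Proof.
move=> [uL gL [f [fD fu fg]]] u0; have oL := D_LV D_one.
pose c k := - (BV one (f k) / NV one).
have c0 : c k @[k --> \oo] --> 0.
  have : BV one (f k) @[k --> \oo] --> BV one u.
    exact: (pairing_cvg mE p1 SV_sym mSV oL (fun k => D_LV (fD k)) uL (NV_cvg_lift fu)).
  rewrite u0 => H; rewrite -[X in _ --> X]oppr0 -[X in _ --> - X](mul0r (NV one)^-1).
  by apply: cvgN; exact: cvgMr_tmp.
have grE k x : E x -> gr (fun x => c k * 1 + f k x) x = gr (f k) x.
  by move=> Ex; rewrite gr_lin// gr_one// scaler0 add0r.
exists (fun k x => c k * 1 + f k x); split.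
- by move=> k; exact: D_lin.
- move=> k; rewrite (BV_lin _ oL oL (D_LV (fD k))) (pairingxx mu p1 SV_sym).
  by rewrite /c mulNr divfK ?gt_eqF// addNr.
- have bnd k : `|NV (fun x => c k * 1 + f k x - u x)| <=
      2 `^ p * (`|c k| `^ p * NV one + NV (fun x => f k x - u x)).
    rewrite (ger0_norm (energy_ge0 _ _ _ _ _)) -(energyZ mE _ oL).
    have -> : lift (fun x => c k * 1 + f k x - u x) =
        fun x => c k *: lift one x + lift (fun x => f k x - u x) x.
      by rewrite -liftD; congr lift; apply/funext => x; rewrite addrA.
    apply: (energyD_le2 mE p1 SV_sym mSV); first exact: in_LZ.
    by rewrite liftB; exact: (in_LB mE p1 SV_sym mSV (D_LV (fD k)) uL).
  apply: (cvg_dist_le (a := fun k =>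
      2 `^ p * (`|c k| `^ p * NV one + NV (fun x => f k x - u x)))).
    by move=> k; rewrite subr0; exact: bnd.
  have cp : `|c k| `^ p @[k --> \oo] --> 0.
    apply: powR_cvg0_seq => //; rewrite -[X in _ --> X](@normr0 _ R).
    exact: cvg_norm.
  exact: (cvg0_combination (2 `^ p) (NV one) cp fu).
- apply: (cvg_ext _ fg) => k; apply: (eq_energy mu p SQ) => x Ex.
  by rewrite grE.
Qed.

Lemma weak_solution_energy f u g : LV f -> abstract_weak_solution f u g ->
  NQ g = - BV f u.
Proof.
move=> fL [Hs u0 ws]; have [uL gL _] := Hs.
have [h [hD h0 hu hg]] := in_space_approx Hs u0.
have H1 : BQ g (gr (h k)) @[k --> \oo] --> NQ g.
  rewrite -(pairingxx mu p1 SQ_sym).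
  exact: (pairing_cvg mE p1 SQ_sym mSQ gL (fun k => D_LQ (hD k)) gL hg).
have H2 : BQ g (gr (h k)) @[k --> \oo] --> - BV f u.
  apply: (cvg_ext (fun k => ws _ (hD k) (h0 k))); apply: cvgN.
  exact: (pairing_cvg mE p1 SV_sym mSV fL (fun k => D_LV (hD k)) uL (NV_cvg_lift hu)).
by rewrite -(cvg_lim _ H1)// -(cvg_lim _ H2).
Qed.

Definition abstract_neumann : Prop :=
  (forall f, LV f -> exists u g, abstract_weak_solution f u g) /\
  exists2 K : R, 0 < K & forall f, LV f -> forall u g,
    abstract_weak_solution f u g -> NV u <= K * NV f.

Definition abstract_poincare : Prop :=
  exists2 C : R, 0 < C & forall f, D f -> BV one f = 0 -> NV f <= C * NQ (gr f).

Lemma BV_le e f h : 0 < e -> LV f -> LV h ->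
  `|BV f h| <= e * NV f + e `^ (1 - p) * NV h.
Proof. exact: (pairing_le mE p1 SV_sym mSV). Qed.

Lemma BV_le1 f h : LV f -> LV h -> `|BV f h| <= NV f + NV h.
Proof.
move=> fL hL; move: (BV_le ltr01 fL hL).
by move: (NV f) (NV h) (BV f h) => a b c; rewrite powR1 !mul1r.
Qed.

(** It prescribes the coefficient of the second term in Young's inequality, for the cases where that
    term is the one to be absorbed. *)
Lemma eps_exists (c : R) : 0 < c -> exists2 e : R, 0 < e & e `^ (1 - p) = c.
Proof.
move=> c0; have np : 1 - p != 0 by rewrite subr_eq0 eq_sym gt_eqF.
exists (c `^ (1 - p)^-1); first exact: powR_gt0.
by rewrite -powRrM mulVf// powRr1// ltW.
Qed.

Lemma neumann_imp_poincare : abstract_neumann -> abstract_poincare.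
Proof.
move=> [exs [K K0 HK]].
have K1 : 0 < 1 + K by rewrite addr_gt0.
(* As NQ g <= (1 + K) NV f, this makes e NQ g at most half of NV f, which the left side absorbs. *)
pose e := (2 * (1 + K))^-1.
have e0 : 0 < e by rewrite invr_gt0 mulr_gt0.
have ep0 : 0 < e `^ (1 - p) by rewrite powR_gt0.
exists (2 * e `^ (1 - p)); first by rewrite mulr_gt0.
move=> f fD f0; have fL := D_LV fD.
have [u [g ws]] := exs f fL.
have [[uL gL _] u0 wsf] := ws.
have Ng := weak_solution_energy fL ws.
have Nu := HK f fL u g ws.
have t1 := wsf f fD f0; rewrite (pairingxx mu p1 SV_sym) in t1.
have := pairing_le mE p1 SQ_sym mSQ e0 gL (D_LQ fD); rewrite t1 normrN.
rewrite (ger0_norm (energy_ge0 _ _ _ _ _)) => H1.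
have H2 := BV_le1 fL uL.
have H3 : NQ g <= NV f + NV u by rewrite Ng (le_trans _ H2)// -normrN ler_norm.
have f0' := energy_ge0 mu E p SV (lift f).
rewrite -mulrA; move: H1 H3 Nu f0' {H2 t1 wsf Ng}.
move: (NV f) (NV u) (NQ g) (NQ (gr f)) => a b c k H1 H3 H4 a0.
have H5 : e * c <= a / 2.
  have -> : a / 2 = e * ((1 + K) * a) by rewrite /e; field; rewrite gt_eqF.
  rewrite ler_pM2l// mulrDl mul1r; exact: le_trans H3 (lerD (lexx a) H4).
move: H1 H5; move: (e * c) (e `^ (1 - p) * k) => z w; lra.
Qed.

Lemma in_space_poincare (C : R) u g : 0 < C ->
  (forall f, D f -> BV one f = 0 -> NV f <= C * NQ (gr f)) ->
  in_space u g -> BV one u = 0 -> NV u <= C * NQ g.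
Proof.
move=> C0 HC Hs u0; have [uL gL _] := Hs.
have [f [fD f0 fu fg]] := in_space_approx Hs u0.
have c1 : NV (f k) @[k --> \oo] --> NV u.
  exact: (energy_cvg mE p1 SV_sym mSV (fun k => D_LV (fD k)) uL (NV_cvg_lift fu)).
have c2 : C * NQ (gr (f k)) @[k --> \oo] --> C * NQ g.
  apply: cvgMl_tmp.
  exact: (energy_cvg mE p1 SQ_sym mSQ (fun k => D_LQ (fD k)) gL fg).
by apply: (cvg_le_lim c1 c2) => k; exact: HC.
Qed.

Lemma poincare_estimate (C : R) : 0 < C ->
  (forall f, D f -> BV one f = 0 -> NV f <= C * NQ (gr f)) ->
  exists2 K : R, 0 < K & forall f, LV f -> forall u g,
    abstract_weak_solution f u g -> NV u <= K * NV f.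
Proof.
(* With this coefficient, multiplication by the Poincare constant C leaves half of NV u to be
   absorbed. *)
move=> C0 HC; have C2 : 0 < (2 * C)^-1 by rewrite invr_gt0 mulr_gt0.
have [e e0 ec] := eps_exists C2.
exists (2 * C * e); first by rewrite !mulr_gt0.
move=> f fL u g ws; have [Hs u0 _] := ws; have [uL gL _] := Hs.
have H1 := in_space_poincare C0 HC Hs u0.
have H2 := BV_le e0 fL uL; rewrite ec in H2.
have H3 := weak_solution_energy fL ws.
have H4 : NQ g <= e * NV f + (2 * C)^-1 * NV u.
  by rewrite H3; apply: le_trans H2; rewrite -normrN ler_norm.
move: H1 H4 {H2 H3}; move: (NV u) (NQ g) (NV f) => a b c H1 H2.
have := le_trans H1 (_ : _ <= C * (e * c + (2 * C)^-1 * a)).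
rewrite ler_pM2l// => /(_ H2).
have -> : C * (e * c + (2 * C)^-1 * a) = C * e * c + a / 2 by field; rewrite gt_eqF.
by rewrite -!mulrA; move: (C * (e * c)) => z; lra.
Qed.

Lemma poincare_imp_exists (C : R) : 0 < C ->
  (forall f, D f -> BV one f = 0 -> NV f <= C * NQ (gr f)) ->
  forall f, LV f -> exists u g, abstract_weak_solution f u g.
Proof.
move=> C0 HC f fL.
pose D0 h := D h /\ BV one h = 0.
have oL := D_LV D_one.
have D0_lin a h k : D0 h -> D0 k -> D0 (fun x => a * h x + k x).
  move=> [hD h0] [kD k0]; split; first exact: D_lin.
  by rewrite (BV_lin _ oL (D_LV hD) (D_LV kD)) h0 k0 mulr0 addr0.
(* The zero function, in the form in which [D_lin] and [D_one] produce it. *)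
pose zero : T -> R := fun x => -1 * 1 + 1.
have D0z : D0 zero.
  split; first by apply: D_lin.
  by rewrite (BV_lin _ oL oL oL) mulN1r addNr.
pose J h := NQ (gr h) + p * BV f h.
(* By the Poincare inequality p (2pC)^-1 NV h is at most half of NQ (gr h), so the linear part of J
   leaves the other half: J is coercive. *)
have c0 : 0 < (2 * p * C)^-1 by rewrite invr_gt0 !mulr_gt0.
have [e e0 ec] := eps_exists c0.
pose K := p * e * NV f.
have coercive h : D0 h -> NQ (gr h) <= 2 * (J h + K).
  move=> [hD h0].
  have H1 := BV_le e0 fL (D_LV hD); rewrite ec in H1.
  have H2 := HC h hD h0.
  move: H1 H2; rewrite /J /K => /ler_normlP[H1 _].
  move: (NV f) (NV h) (BV f h) (NQ (gr h)) H1 => a b x y H1 H2.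
  have H3 : p * - x <= p * (e * a + (2 * p * C)^-1 * b) by rewrite ler_pM2l.
  have H4 : p * ((2 * p * C)^-1 * b) <= y / 2.
    have -> : p * ((2 * p * C)^-1 * b) = C^-1 * b / 2.
      by field; rewrite !gt_eqF.
    by rewrite ler_pM2r// ler_pdivrMl.
  move: H3 H4; rewrite mulrN mulrDr -!mulrA.
  by move: (p * x) (p * (e * a)) (p * (_ * b)) => X Y Z; lra.
clearbody K.
have J_lb h : D0 h -> - K <= J h.
  move=> hD0; have := coercive h hD0.
  have := energy_ge0 mu E p SQ (gr h).
  by move: (J h) (NQ (gr h)) => a b; lra.
pose A := [set J h | h in D0].
have A0 : A !=set0 by exists (J zero); exists zero.
have lbA : has_lbound A by exists (- K) => _ [h hD0 <-]; exact: J_lb.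
have infA : has_inf A by split.
pose mn := inf A.
have J_ge h : D0 h -> mn <= J h by move=> hD0; apply: ge_inf => //; exists h.
have [w Hw] : {w : nat -> T -> R & forall k, D0 (w k) /\ J (w k) <= mn + k.+1%:R^-1}.
  apply: (@choice _ _ (fun k h => D0 h /\ J h <= mn + k.+1%:R^-1)) => k.
  have k0 : 0 < k.+1%:R^-1 :> R by rewrite invr_gt0.
  have [_ [h hD0 <-] hJ] := inf_adherent k0 infA.
  by exists h; split => //; exact: ltW.
have wD0 k : D0 (w k) := (Hw k).1.
have wD k : D (w k) := (wD0 k).1.
have wm k : BV one (w k) = 0 := (wD0 k).2.
have wJ k : J (w k) <= mn + k.+1%:R^-1 := (Hw k).2.
have cauchy_gr r : 0 < r -> exists N, forall k l, (N <= k)%N -> (N <= l)%N ->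
    NQ (fun x => gr (w k) x - gr (w l) x) <= r.
  move=> r0.
  pose M := 2 * (mn + 1 + K).
  have NM k : NQ (gr (w k)) <= M.
    apply: le_trans (coercive _ (wD0 k)) _; rewrite ler_pM2l// lerD2r.
    by apply: le_trans (wJ k) _; rewrite lerD2l invf_le1// ler1n.
  have M0 : 0 <= M := le_trans (energy_ge0 mu E p SQ _) (NM 0%N).
  have tp : 0 < 2 `^ p :> R by rewrite powR_gt0.
  (* Together with r1, this allots half of r / 2^p to each term of the convexity inequality; 2^p
     undoes the factor 1/2 in front of the difference. *)
  pose e1 := r / (2 `^ p * 4 * (M + 1)).
  have M1 : 0 < M + 1 by rewrite ltr_wpDl.
  have e10 : 0 < e1 by rewrite divr_gt0// !mulr_gt0.
  have [C1 C10 HC1] := energy_unif_convex mu mE p1 SQ_sym mSQ e10.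
  pose r1 := r / (2 `^ p * 4 * C1).
  have r10 : 0 < r1 by rewrite divr_gt0// !mulr_gt0.
  have /cvgr0Pnorm_le /(_ _ r10)[N _ HN] := @cvg_harmonic R.
  exists N => k l Nk Nl.
  have Hk := le_trans (ler_norm _) (HN k Nk); have Hl := le_trans (ler_norm _) (HN l Nl).
  have gk := D_LQ (wD k); have gl := D_LQ (wD l).
  (* The midpoint is a competitor, and the linear part of J is exact there, so the convexity defect
     of the energies is at most 1/(k+1) + 1/(l+1). *)
  pose avg := fun x => 2^-1 * w k x + (2^-1 * w l x + zero x).
  have avgD0 : D0 avg.
    exact: (D0_lin _ _ _ (wD0 k) (D0_lin _ _ _ (wD0 l) D0z)).
  have H2 : NQ (fun x => 2^-1 *: (gr (w k) x + gr (w l) x)) = NQ (gr avg).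
    apply/esym/(eq_energy mu p SQ) => x Ex.
    have lzD := (D0_lin 2^-1 (w l) zero (wD0 l) D0z).1.
    rewrite (gr_lin _ (wD k) lzD Ex) (gr_lin _ (wD l) D0z.1 Ex) (gr_lin _ D_one D_one Ex).
    by rewrite (gr_one Ex) scaler0 !addr0 scalerDr.
  have H3 : BV f avg = 2^-1 * BV f (w k) + 2^-1 * BV f (w l).
    rewrite (BV_lin _ fL (D_LV (wD k)) (D_LV (D0_lin 2^-1 (w l) zero (wD0 l) D0z).1)).
    rewrite (BV_lin _ fL (D_LV (wD l)) (D_LV D0z.1)) (BV_lin _ fL oL oL).
    by rewrite mulN1r addNr addr0.
  have H1 := HC1 _ _ gk gl; rewrite H2 in H1.
  have H4 := J_ge _ avgD0; rewrite /J H3 in H4.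
  have H5 := wJ k; have H6 := wJ l; rewrite /J in H5 H6.
  have E1 : NQ (fun x => gr (w k) x - gr (w l) x) =
      2 `^ p * NQ (fun x => 2^-1 *: (gr (w k) x - gr (w l) x)).
    rewrite (energyZ mE 2^-1 (in_LB mE p1 SQ_sym mSQ gk gl)) mulrA powR_two_half.
    exact: esym (mul1r _).
  rewrite E1; have B1 := NM k; have B2 := NM l.
  rewrite /= in Hk Hl.
  move: H1 H4 H5 H6 B1 B2 {E1 H2 H3}.
  move: (NQ (fun x => 2^-1 *: (gr (w k) x - gr (w l) x))) (NQ (gr avg)).
  move: (NQ (gr (w k))) (NQ (gr (w l))) (BV f (w k)) (BV f (w l)).
  move=> a b y z X Y H1 H4 H5 H6 B1 B2.
  have H7 : a + b - 2 * Y <= 2 * r1.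
    have {}H4 : 2 * mn <= 2 * Y + p * y + p * z.
      have -> : 2 * Y + p * y + p * z = 2 * (Y + p * (2^-1 * y + 2^-1 * z)) by field.
      by rewrite ler_pM2l.
    move: H4 H5 H6 Hk Hl; move: (p * y) (p * z) (k.+1%:R^-1) (l.+1%:R^-1) => *; lra.
  have H8 : e1 * (a + b) <= e1 * (2 * (M + 1)) by rewrite ler_pM2l//; move: B1 B2 {H1 H4 H5 H6}; lra.
  have H9 : C1 * (a + b - 2 * Y) <= C1 * (2 * r1) by rewrite ler_pM2l.
  have H10 : X <= r / 2 `^ p.
    apply: le_trans H1 _; apply: le_trans (lerD H8 H9) _.
    rewrite le_eqVlt; apply/orP; left; apply/eqP; rewrite /e1 /r1.
    by field; rewrite !gt_eqF.
  by rewrite mulrC -ler_pdivlMr.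
(* The Poincare inequality, applied to the mean-zero difference of two terms, transfers the Cauchy
   property from gradients to functions. *)
have cauchy_w r : 0 < r -> exists N, forall k l, (N <= k)%N -> (N <= l)%N ->
    energy mu E p SV (fun x => lift (w k) x - lift (w l) x) <= r.
  move=> r0; have rC : 0 < r / C by rewrite divr_gt0.
  have [N HN] := cauchy_gr _ rC; exists N => k l Nk Nl.
  have H1 := HN k l Nk Nl.
  pose dif := fun x => -1 * w l x + w k x.
  have [dD dm] : D0 dif by exact: (D0_lin _ _ _ (wD0 l) (wD0 k)).
  have E1 : NQ (gr dif) = NQ (fun x => gr (w k) x - gr (w l) x).
    apply: (eq_energy mu p SQ) => x Ex.
    by rewrite (gr_lin _ (wD l) (wD k) Ex) scaleN1r addrC.
  have E2 : NV dif = energy mu E p SV (fun x => lift (w k) x - lift (w l) x).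
    apply: (eq_energy mu p SV) => x Ex.
    by rewrite liftD scaleN1r addrC.
  rewrite -E2; apply: le_trans (HC _ dD dm) _; rewrite E1.
  by rewrite mulrC -ler_pdivlMr.
have [g gL wg] := energy_complete mE p1 SQ_sym mSQ (fun k => D_LQ (wD k)) cauchy_gr.
have [U UL wU] := energy_complete mE p1 SV_sym mSV (fun k => D_LV (wD k)) cauchy_w.
pose u x := U x 0 0; rewrite -(lift_coord U) -/u in UL wU.
have wu : NV (fun x => w k x - u x) @[k --> \oo] --> 0.
  by apply: (cvg_ext _ wU) => k; rewrite liftB.
have cB h : LV h -> BV h (w k) @[k --> \oo] --> BV h u.
  by move=> hL; exact: (pairing_cvg mE p1 SV_sym mSV hL (fun k => D_LV (wD k)) UL wU).
have u0 : BV one u = 0.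
  have H := cB _ oL; apply/esym; rewrite -(cvg_lim _ H)//.
  by rewrite (_ : (fun k => BV one (w k)) = fun=> 0) ?lim_cst//; exact/funext.
exists u, g; split => //; first by split => //; exists w; split.
move=> phi phiD phi0.
have phL := D_LV phiD; have pgL := D_LQ phiD.
apply: (energy_minimizer_pairing mE p1 SQ_sym mSQ gL pgL) => t.
have J1 : NQ g + p * BV f u <= mn.
  have h2 : J (w k) @[k --> \oo] --> NQ g + p * BV f u.
    apply: cvgD; last by apply: cvgMl_tmp; exact: cB.
    exact: (energy_cvg mE p1 SQ_sym mSQ (fun k => D_LQ (wD k)) gL wg).
  have h3 : mn + k.+1%:R^-1 @[k --> \oo] --> mn.
    by rewrite -[X in _ --> X]addr0; apply: cvgD; [exact: cvg_cst|exact: cvg_harmonic].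
  exact: (cvg_le_lim h2 h3 wJ).
(* The pair (u, g) need not come from [D], so the infimum is compared with J at w_k + t phi, and the
   inequality is passed to the limit. *)
have J2 : mn <= NQ (fun x => g x + t *: gr phi x) + p * (t * BV f phi + BV f u).
  have tL : LQ (fun x => t *: gr phi x) by exact: in_LZ.
  have h1 : NQ (fun x => gr (w k) x + t *: gr phi x) @[k --> \oo] -->
      NQ (fun x => g x + t *: gr phi x).
    apply: (energy_cvg mE p1 SQ_sym mSQ).
    - by move=> k; exact: (in_LD mE p1 SQ_sym mSQ (D_LQ (wD k)) tL).
    - exact: (in_LD mE p1 SQ_sym mSQ gL tL).
    - apply: (cvg_ext _ wg) => k; apply: (eq_energy mu p SQ) => x _.
      by rewrite opprD addrACA subrr addr0.
  have h2 : NQ (fun x => gr (w k) x + t *: gr phi x) + p * (t * BV f phi + BV f (w k))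
      @[k --> \oo] --> NQ (fun x => g x + t *: gr phi x) + p * (t * BV f phi + BV f u).
    apply: cvgD h1 _; apply: cvgMl_tmp; apply: cvgD; first exact: cvg_cst.
    exact: cB.
  have h3 : mn @[k --> \oo] --> mn by exact: cvg_cst.
  apply: (cvg_le_lim h3 h2) => k.
  have D0k : D0 (fun x => t * phi x + w k x) by exact: (D0_lin _ _ _ (conj phiD phi0) (wD0 k)).
  have := J_ge _ D0k; rewrite /J (BV_lin _ fL phL (D_LV (wD k))).
  suff -> : NQ (gr (fun x => t * phi x + w k x)) = NQ (fun x => gr (w k) x + t *: gr phi x) by [].
  by apply: (eq_energy mu p SQ) => x Ex; rewrite (gr_lin _ phiD (wD k) Ex) addrC.
move: J1 J2; rewrite mulrDr; move: (NQ g) (NQ (fun x => g x + t *: gr phi x)) (p * BV f u) (p * (t * BV f phi)).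
by move=> a b y z J1 J2; lra.
Qed.

Lemma neumann_iff_poincare : abstract_neumann <-> abstract_poincare.
Proof.
split; first exact: neumann_imp_poincare.
move=> [C C0 HC]; split; first exact: poincare_imp_exists HC.
exact: poincare_estimate HC.
Qed.

End abstract_neumann_poincare.

(** * Finiteness of extended-real norms as integrability *)

Section ereal_power.
Context d (T : measurableType d) (R : realType).
Variables (mu : {measure set T -> \bar R}) (E : set T) (F : T -> R) (r : R).
Hypotheses (mE : measurable E) (r0 : 0 < r) (F0 : forall x, E x -> 0 <= F x).

Lemma integrable_iff_powR_lty : measurable_fun E F ->
  mu.-integrable E (EFin \o F) <->
  ((\int[mu]_(x in E) (F x)%:E) `^ r < +oo)%E.
Proof.
move=> mF; have Eabs : (\int[mu]_(x in E) `|(F x)%:E| = \int[mu]_(x in E) (F x)%:E)%E.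
  by apply: eq_integral => x /[!inE] Ex; rewrite gee0_abs// lee_fin F0.
split=> [/integrableP[_ H]|H].
  by apply: poweR_lty; rewrite -Eabs.
apply/integrableP; split; first exact/measurable_EFinP.
by rewrite Eabs; apply: (@lty_poweRy _ _ r) => //; rewrite gt_eqF.
Qed.

Lemma integral_Rintegral : mu.-integrable E (EFin \o F) ->
  (\int[mu]_(x in E) (F x)%:E = (\int[mu]_(x in E) F x)%R%:E)%E.
Proof.
by move=> iF; rewrite /Rintegral fineK//; exact: integrable_fin_num iF.
Qed.
End ereal_power.

(** * The spaces of the statement *)

Section space_lemmas.
Variables (R : realType) (n : nat).
Local Notation V := 'rV[R]_n.+1.
Local Notation T := (lebesgue_space R n).
Variable E : set V.
Hypothesis E_open : open E.
Hypothesis E_bounded : bounded_set E.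

Lemma closure_bounded_compact : compact (closure E).
Proof.
apply: bounded_closed_compact; last exact: closed_closure.
(* One unit is for the bound M + 1 on E, valid because it exceeds M strictly, and one for the
   distance from x to a point of E. *)
have [M [Mr HM]] := E_bounded; exists (M + 2); split; first by rewrite realD.
move=> N MN x Ex; have [y [Ey xy]] := Ex _ (nbhsx_ballx x 1 ltr01).
have M1 : M < M + 1 by rewrite ltrDl.
have yM := HM _ M1 y Ey.
rewrite -ball_normE /= in xy.
have xyy : `|x| <= `|x - y| + `|y| by rewrite -{1}(subrK y x) ler_normD.
have H := le_trans xyy (lerD (ltW xy) yM).
by apply: (le_trans H); move: MN; lra.
Qed.

Lemma extends_to_closure_bounded f : extends_to_closure E f ->
  exists2 M : R, 0 <= M & forall x, E x -> `|f x| <= M.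
Proof.
move=> [h [ch hf]].
have /compact_bounded[M [_ HM]] := continuous_compact ch closure_bounded_compact.
exists (`|M| + 1); first by rewrite addr_ge0.
move=> x Ex; apply: HM; first by rewrite (le_lt_trans (ler_norm M))// ltrDl.
by exists x; [exact: subset_closure | exact: hf].
Qed.

Lemma open_continuous_lebesgue_measurable (h : V -> R) :
  {within E, continuous h} -> measurable_fun (E : set T) (h : T -> R).
Proof.
rewrite continuous_open_subspace// => ch.
apply: (measurability _ (RGenOpens.measurableE R)).
move=> _ [_ [a [b ->] <-]]; apply: open_lebesgue_measurable.
rewrite openE => x [Ex hx]; apply: filterI; first exact: open_nbhs_nbhs.
by apply: (ch x); [rewrite inE|apply: open_nbhs_nbhs; split => //; exact: interval_open].
Qed.

Lemma extends_to_closure_measurable f : extends_to_closure E f ->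
  measurable_fun (E : set T) (f : T -> R).
Proof.
move=> [h [ch hf]]; apply: (@eq_measurable_fun _ _ _ _ _ (h : T -> R)).
  by move=> x /[!inE] Ex; exact: hf.
apply: open_continuous_lebesgue_measurable.
exact: continuous_subspaceW (@subset_closure _ E) ch.
Qed.

Lemma extends_to_closure_lin (a : R) (f g : V -> R) : extends_to_closure E f ->
  extends_to_closure E g -> extends_to_closure E (fun x => a * f x + g x).
Proof.
move=> [h [ch hf]] [k [ck kg]]; exists (fun x => a * h x + k x); split.
  by move=> x; apply: cvgD; [apply: cvgM; [exact: cvg_cst|exact: ch]|exact: ck].
by move=> x Ex; rewrite hf// kg.
Qed.

Lemma partial_lin (a : R) (f g : V -> R) i (x : V) : differentiable f x -> differentiable g x ->
  partial i (fun x => a * f x + g x) x = a * partial i f x + partial i g x.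
Proof.
move=> df dg; rewrite /partial.
have -> : (fun x : V => a * f x + g x) = (a \*: f) + g by [].
rewrite deriveD; [|exact/derivableZ/diff_derivable|exact: diff_derivable].
by rewrite deriveZ//; exact: diff_derivable.
Qed.

Lemma extends_to_closure_eq f g : (forall x, E x -> f x = g x) ->
  extends_to_closure E f -> extends_to_closure E g.
Proof.
by move=> fg [h [ch hf]]; exists h; split => // x Ex; rewrite hf// fg.
Qed.

Lemma C1_closure_lin (a : R) (f g : V -> R) : C1_closure E f -> C1_closure E g ->
  C1_closure E (fun x => a * f x + g x).
Proof.
move=> [df ef pf] [dg eg pg]; split.
- move=> x Ex; have -> : (fun x : V => a * f x + g x) = (a *: f) + g by [].
  by apply: differentiableD; [apply: differentiableZ; exact: df|exact: dg].
- exact: extends_to_closure_lin.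
- move=> i; apply: (extends_to_closure_eq (f := fun x => a * partial i f x + partial i g x)).
    by move=> x Ex; rewrite partial_lin//; [exact: df|exact: dg].
  exact: extends_to_closure_lin.
Qed.

Lemma grad_lin (a : R) (f g : V -> R) : C1_closure E f -> C1_closure E g -> forall x, E x ->
  grad (fun x => a * f x + g x) x = a *: grad f x + grad g x.
Proof.
move=> [df _ _] [dg _ _] x Ex; apply/matrixP => i j; rewrite !mxE.
by rewrite partial_lin//; [exact: df|exact: dg].
Qed.

Lemma grad_cst (c : R) (x : V) : grad (fun _ : V => c) x = 0.
Proof.
by apply/matrixP => i j; rewrite !mxE; exact: (derive_cst c x (delta_mx 0 i)).
Qed.

Lemma C1_closure_cst (c : R) : C1_closure E (fun _ : V => c).
Proof.
have ec k : extends_to_closure E (fun=> k).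
  by exists (fun=> k); split => // x; exact: cvg_cst.
split; [by move=> x _; exact: differentiable_cst | exact: ec | move=> i].
apply: (extends_to_closure_eq (f := fun=> 0)); last exact: ec.
by move=> x Ex; apply/esym; exact: (derive_cst c x (delta_mx 0 i)).
Qed.

Lemma grad_measurable f : C1_closure E f -> mx_measurable (E : set T) (grad f : T -> _).
Proof.
move=> [_ _ pf] i j; apply: (@eq_measurable_fun _ _ _ _ _ (partial i f : T -> R)).
  by move=> x _; rewrite mxE.
exact: extends_to_closure_measurable.
Qed.

End space_lemmas.

Lemma energy_eq0 d (T : measurableType d) (R : realType)
    (mu : {measure set T -> \bar R}) (E : set T) (p : R) (m : nat)
    (S : T -> 'M[R]_m) (g : T -> 'cV[R]_m) :
  0 < p -> (forall x, E x -> g x = 0) -> energy mu E p S g = 0.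
Proof.
move=> p0 g0; rewrite energyE /Rintegral.
under eq_integral => x xE.
  rewrite /pnorm g0; last by rewrite inE in xE.
  rewrite mulmx0 enorm0 powR0 ?gt_eqF//; over.
by rewrite integral0.
Qed.

(** * Translation of the statement into energies and pairings *)

Section neumann_poincare.
Variables (R : realType) (n : nat) (Omega E : set 'rV[R]_n.+1).
Variables (Q : 'rV[R]_n.+1 -> 'M[R]_n.+1) (v : 'rV[R]_n.+1 -> R) (p : R).
Local Notation V := 'rV[R]_n.+1.
Local Notation T := (lebesgue_space R n).
Local Notation mu := (@lebesgue_nd R n).
Hypotheses (Omega_open : open Omega) (E_open : open E) (E_bounded : bounded_set E).
Hypothesis E_Omega : closure E `<=` Omega.
Hypothesis Q_psd : forall x, Omega x -> psd (Q x).
Hypothesis Q_meas : forall i j, measurable_fun (Omega : set T)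
  ((fun x => Q x i j) : T -> R).
Hypothesis v_weight : weight Omega v.
Hypothesis v_E : (0 < \int[mu]_(x in E) (v x)%:E)%E.
Hypothesis p_gt1 : 1 < p.

Let p0 : 0 < p. Proof. exact: lt_trans p_gt1. Qed.
Let pi0 : 0 < p^-1. Proof. by rewrite invr_gt0. Qed.
Let mE : measurable (E : set T). Proof. exact: open_lebesgue_measurable. Qed.
Let mOmega : measurable (Omega : set T). Proof. exact: open_lebesgue_measurable. Qed.
Let E_sub : E `<=` Omega.
Proof. by move=> x Ex; apply: E_Omega; exact: subset_closure. Qed.
Let v0 x : E x -> 0 <= v x. Proof. by move=> Ex; apply: v_weight.1; exact: E_sub. Qed.
Let mv : measurable_fun (E : set T) (v : T -> R).
Proof. by apply: measurable_funS v_weight.2.1. Qed.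

(** The closure of E is a compact subset of Omega, so local integrability on Omega applies to it. *)
Lemma weight_integrable : mu.-integrable (E : set T) (EFin \o (v : T -> R)).
Proof.
apply/integrableP; split; first exact/measurable_EFinP.
have mc : measurable (closure E : set T).
  rewrite -[closure E]setCK; apply: measurableC; apply: open_lebesgue_measurable.
  exact/closed_openC/closed_closure.
have := v_weight.2.2 _ E_Omega (closure_bounded_compact E_bounded).
apply: le_lt_trans; apply: ge0_subset_integral; [exact: mE|exact: mc| |by []|exact: subset_closure].
apply/measurable_EFinP; apply: (measurableT_comp (f := (@Num.norm R R : R -> R))) => //.
exact: measurable_funS v_weight.2.1.
Qed.

Definition SV (x : T) : 'M[R]_1 := (v x `^ p^-1)%:M.
Definition SQ (x : T) : 'M[R]_n.+1 := mxsqrt (Q x).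

Lemma SV_sym (x : T) : E x -> (SV x)^T = SV x.
Proof. by rewrite /SV tr_scalar_mx. Qed.

Lemma SQ_sym (x : T) : E x -> (SQ x)^T = SQ x.
Proof. by move=> Ex; case: (mxsqrtP (Q_psd (E_sub Ex))). Qed.

Lemma SQ_sqr (x : T) : E x -> SQ x *m SQ x = Q x.
Proof. by move=> Ex; case: (mxsqrtP (Q_psd (E_sub Ex))). Qed.

Lemma measurable_SV_sqr : mx_measurable (E : set T) (fun x => SV x *m SV x).
Proof.
have mS : mx_measurable (E : set T) SV.
  move=> i j; rewrite !ord1; under eq_fun do rewrite mxE eqxx mulr1n.
  by apply: (measurableT_comp (f := @powR R ^~ p^-1)); [exact: measurable_powR | exact: mv].
exact: mx_measurable_mul.
Qed.

Lemma measurable_SQ_sqr : mx_measurable (E : set T) (fun x => SQ x *m SQ x).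
Proof.
move=> i j; apply: (@eq_measurable_fun _ _ _ _ _ ((fun x => Q x i j) : T -> R)).
  by move=> x /[!inE] Ex; rewrite SQ_sqr.
exact: measurable_funS (Q_meas i j).
Qed.

Lemma pnorm_lift (f : T -> R) (x : T) : E x -> pnorm SV (lift f) x `^ p = `|f x| `^ p * v x.
Proof.
move=> Ex; rewrite /pnorm /SV mul_scalar_mx enormZ.
have -> : enorm (lift f x) = `|f x|.
  by rewrite /enorm big_ord1 mxE sqrtr_sqr.
rewrite ger0_norm ?powR_ge0// powRM ?powR_ge0// -powRrM mulVf ?gt_eqF//.
by rewrite powRr1 ?v0// mulrC.
Qed.

Lemma pinner_lift (f phi : T -> R) (x : T) : E x ->
  pinner p SV (lift f) (lift phi) x = `|f x| `^ (p - 2) * f x * phi x * v x.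
Proof.
move=> Ex; rewrite /pinner /pnorm /SV mul_scalar_mx enormZ.
have -> : enorm (lift f x) = `|f x|.
  by rewrite /enorm big_ord1 mxE sqrtr_sqr.
rewrite -scalar_mxM mul_mx_scalar -scalemxAl !mxE big_ord1 !mxE.
rewrite ger0_norm ?powR_ge0//.
have [vx|vx] := eqVneq (v x) 0.
  by rewrite vx powR0 ?invr_eq0 ?gt_eqF// mulr0 !mul0r !mulr0.
have vp : 0 < v x by rewrite lt0r vx v0.
rewrite powRM ?powR_ge0// -powRrM.
have -> : v x `^ p^-1 * v x `^ p^-1 = v x `^ (2 * p^-1).
  by rewrite -powRD ?vx ?implybT//; congr (_ `^ _); ring.
(* The norm contributes v^((p-2)/p) and the two factors SV contribute v^(2/p). *)
have E1 : v x `^ (p^-1 * (p - 2)) * v x `^ (2 * p^-1) = v x.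
  rewrite -powRD ?vx ?implybT// (_ : _ + _ = 1) ?powRr1 ?v0//.
  by field; rewrite gt_eqF.
rewrite -[X in _ = _ * X]E1.
by set a := v x `^ _; set b := v x `^ _; set c := `|f x| `^ _; ring.
Qed.

Lemma in_Lp_iff (f : T -> R) : in_Lp E v p f <-> in_L mu (E : set T) p SV (lift f).
Proof.
have ml : measurable_fun (E : set T) (f : T -> R) <->
    mx_measurable (E : set T) (lift f : T -> _).
  split=> [mf i j|ml]; first by under eq_fun do rewrite mxE.
  by have := ml 0 0; under eq_fun do rewrite mxE.
have H : mx_measurable (E : set T) (lift f : T -> _) ->
    (mu.-integrable (E : set T) (fun x => (pnorm SV (lift f) x `^ p)%:E) <->
     (Lpnorm E v p f < +oo)%E).
  move=> mf; rewrite /Lpnorm.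
  have <- : (\int[mu]_(x in (E : set T)) (pnorm SV (lift f) x `^ p)%:E =
      \int[mu]_(x in (E : set T)) (`|f x| `^ p * v x)%:E)%E.
    by apply: eq_integral => x /[!inE] Ex; rewrite pnorm_lift.
  have mp := measurable_pnorm_powR SV_sym measurable_SV_sqr p mf.
  exact: (integrable_iff_powR_lty mu pi0 (fun x _ => powR_ge0 _ _) mp).
split=> -[mf Lf].
  have ml' := ml.1 mf; exact: (conj ml' ((H ml').2 Lf)).
exact: (conj (ml.2 mf) ((H mf).1 Lf)).
Qed.

Lemma Lpnorm_energy (f : T -> R) : in_L mu (E : set T) p SV (lift f) ->
  Lpnorm E v p f = ((energy mu (E : set T) p SV (lift f)) `^ p^-1)%:E.
Proof.
move=> fL; rewrite /Lpnorm energyE -poweR_EFin -(integral_Rintegral mE fL.2).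
congr (_ `^ _)%E; apply: eq_integral => x /[!inE] Ex.
by rewrite pnorm_lift.
Qed.

Lemma in_LpQ_iff (g : T -> 'cV[R]_n.+1) : in_LpQ E Q p g <-> in_L mu (E : set T) p SQ g.
Proof.
have H : mx_measurable (E : set T) (g : T -> _) ->
    (mu.-integrable (E : set T) (fun x => (pnorm SQ g x `^ p)%:E) <->
     (LpQnorm E Q p g < +oo)%E).
  move=> mg; have mp := measurable_pnorm_powR SQ_sym measurable_SQ_sqr p mg.
  exact: (integrable_iff_powR_lty mu pi0 (fun x _ => powR_ge0 _ _) mp).
split=> -[mg Lg].
  have mg' : mx_measurable (E : set T) (g : T -> _) by move=> i j; rewrite ord1.
  exact: (conj mg' ((H mg').2 Lg)).
exact: (conj (fun i => mg i 0) ((H mg).1 Lg)).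
Qed.

Lemma LpQnorm_energy (g : T -> 'cV[R]_n.+1) : in_L mu (E : set T) p SQ g ->
  LpQnorm E Q p g = ((energy mu (E : set T) p SQ g) `^ p^-1)%:E.
Proof.
by move=> gL; rewrite /LpQnorm energyE -poweR_EFin -(integral_Rintegral mE gL.2).
Qed.

Lemma powR_cvg0_iff (a : nat -> R) : (forall k, 0 <= a k) ->
  (a k `^ p^-1)%:E @[k --> \oo] --> 0%E <-> a k @[k --> \oo] --> 0.
Proof.
move=> a0; split=> [H|H]; last first.
  by apply: cvg_EFin; [exact: nearW | exact: powR_cvg0_seq].
have H1 : a k `^ p^-1 @[k --> \oo] --> 0 by exact: (fine_cvg H).
apply: (cvg_ext (b := fun k => (a k `^ p^-1) `^ p)).
  by move=> k; rewrite -powRrM mulVf ?gt_eqF// powRr1.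
by apply: powR_cvg0_seq => // k; exact: powR_ge0.
Qed.

(** Up to the boundary of E, Q need not be integrable to any power, so a C^1 function on the closure
    may have infinite energy and finiteness is part of the class. The L^p(v) half of the norm is
    finite by [C1_closure_in_L]. *)
Definition test_function (phi : T -> R) : Prop :=
  C1_closure E phi /\ in_L mu (E : set T) p SQ (grad phi).

Lemma eq_in_L (m : nat) (S : T -> 'M[R]_m) (g h : T -> 'cV[R]_m) : (forall x, E x -> g x = h x) ->
  in_L mu (E : set T) p S g -> in_L mu (E : set T) p S h.
Proof.
move=> gh [mg ig]; split.
  move=> i j; apply: (@eq_measurable_fun _ _ _ _ _ (fun x => g x i j)) => //.
  by move=> x /[!inE] Ex; rewrite gh.
by move: ig; apply: (eq_integrable mE) => x /[!inE] Ex; rewrite /pnorm gh.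
Qed.

(** A continuous function on the compact closure is bounded, and v is integrable on E. *)
Lemma C1_closure_in_L (f : T -> R) : C1_closure E f -> in_L mu (E : set T) p SV (lift f).
Proof.
move=> [_ ef _]; have mf := extends_to_closure_measurable E_open ef.
have ml : mx_measurable (E : set T) (lift f : T -> _).
  by move=> i j; under eq_fun do rewrite mxE.
split => //; have [M M0 fM] := extends_to_closure_bounded E_bounded ef.
have iM : mu.-integrable (E : set T) (EFin \o (fun x : T => M `^ p * v x)).
  by have := integrableZl mE (M `^ p) weight_integrable; apply: eq_integrable.
apply: (integrable_dom mE _ iM).
  exact: (measurable_pnorm_powR SV_sym measurable_SV_sqr p ml).
move=> x Ex; rewrite ger0_norm ?powR_ge0// pnorm_lift// ler_wpM2r ?v0//.
by apply: (powR_le (ltW p0)); rewrite ?normr_ge0 ?fM.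
Qed.

Lemma test_function_lin (a : R) (f g : T -> R) : test_function f -> test_function g ->
  test_function (fun x => a * f x + g x).
Proof.
move=> [fC fL] [gC gL]; split; first exact: C1_closure_lin.
apply: (eq_in_L (g := fun x => a *: grad f x + grad g x)).
  by move=> x Ex; rewrite (grad_lin a fC gC Ex).
exact: (in_LD mE p_gt1 SQ_sym measurable_SQ_sqr (in_LZ mE a fL) gL).
Qed.

Lemma test_function_cst (c : R) : test_function (fun=> c).
Proof.
split; first exact: C1_closure_cst.
have zL : in_L mu (E : set T) p SQ (fun=> 0).
  split; first exact: mx_measurable_cst.
  move: (integrable0 mu (E : set T)); apply: (eq_integrable mE) => x _.
  by rewrite /pnorm mulmx0 enorm0 powR0 ?gt_eqF.
by apply: eq_in_L zL => x _; rewrite grad_cst.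
Qed.

Lemma energy_one : energy mu (E : set T) p SV (lift (fun _ : T => 1)) = vmass E v.
Proof.
rewrite energyE /vmass; apply: eq_Rintegral => x /[!inE] Ex.
by rewrite pnorm_lift// normr1 powR1 mul1r.
Qed.

Lemma vmass_gt0 : 0 < vmass E v.
Proof.
by rewrite -lte_fin /vmass -(integral_Rintegral mE weight_integrable).
Qed.

Lemma pairing_one (u : T -> R) :
  pairing mu (E : set T) p SV (lift (fun _ : T => 1)) (lift u) =
  (\int[mu]_(x in (E : set T)) (u x * v x))%R.
Proof.
rewrite pairingE; apply: eq_Rintegral => x /[!inE] Ex.
by rewrite pinner_lift// normr1 powR1 !mul1r.
Qed.

Let one_L := C1_closure_in_L (C1_closure_cst E 1).

Lemma integrable_mean (u : T -> R) : in_L mu (E : set T) p SV (lift u) ->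
  mu.-integrable (E : set T) (EFin \o (fun x : T => u x * v x)).
Proof.
move=> uL; have := integrable_pinner mE p_gt1 SV_sym measurable_SV_sqr one_L uL.
apply: eq_integrable => // x /[!inE] Ex /=.
by rewrite pinner_lift// normr1 powR1 !mul1r.
Qed.

Lemma in_H_iff (u : T -> R) (g : T -> 'cV[R]_n.+1) : in_H E v Q p u g <->
  in_space mu (E : set T) p SV SQ test_function (@grad R n) u g.
Proof.
have cv (f : nat -> T -> R) : in_L mu (E : set T) p SV (lift u) ->
    (forall k, in_L mu (E : set T) p SV (lift (f k))) ->
    Lpnorm E v p (fun x => f k x - u x) @[k --> \oo] --> 0%E <->
    energy mu (E : set T) p SV (lift (fun x => f k x - u x)) @[k --> \oo] --> 0.
  move=> uL fL; rewrite -powR_cvg0_iff; last by move=> k; exact: energy_ge0.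
  have H k : Lpnorm E v p (fun x => f k x - u x) =
      (energy mu (E : set T) p SV (lift (fun x => f k x - u x)) `^ p^-1)%:E.
    apply: Lpnorm_energy; rewrite liftB.
    exact: (in_LB mE p_gt1 SV_sym measurable_SV_sqr (fL k) uL).
  by have -> : (fun k => Lpnorm E v p (fun x => f k x - u x)) = _ := funext H.
have cq (f : nat -> T -> R) : in_L mu (E : set T) p SQ g ->
    (forall k, in_L mu (E : set T) p SQ (grad (f k))) ->
    LpQnorm E Q p (fun x => grad (f k) x - g x) @[k --> \oo] --> 0%E <->
    energy mu (E : set T) p SQ (fun x => grad (f k) x - g x) @[k --> \oo] --> 0.
  move=> gL fL; rewrite -powR_cvg0_iff; last by move=> k; exact: energy_ge0.
  have H k : LpQnorm E Q p (fun x => grad (f k) x - g x) =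
      (energy mu (E : set T) p SQ (fun x => grad (f k) x - g x) `^ p^-1)%:E.
    apply: LpQnorm_energy.
    exact: (in_LB mE p_gt1 SQ_sym measurable_SQ_sqr (fL k) gL).
  by have -> : (fun k => LpQnorm E Q p (fun x => grad (f k) x - g x)) = _ := funext H.
split=> [[/in_Lp_iff uL /in_LpQ_iff gL [f [fD fu fg]]]|[uL gL [f [fD fu fg]]]].
  have fC k : C1_closure E (f k) := (fD k).1.
  have fLV k := C1_closure_in_L (fC k).
  have fLQ k : in_L mu (E : set T) p SQ (grad (f k)).
    apply/in_LpQ_iff; split; first by move=> i; exact: grad_measurable.
    apply: le_lt_trans (fD k).2; rewrite leeDr//; exact: poweR_ge0.
  split; [exact: uL | exact: gL | exists f; split].
  - by move=> k; split; [exact: fC | exact: fLQ].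
  - exact: (cv f uL fLV).1 fu.
  - exact: (cq f gL fLQ).1 fg.
have fLV k := C1_closure_in_L (fD k).1.
split; [exact: (in_Lp_iff u).2 uL|exact: (in_LpQ_iff g).2 gL|exists f; split].
- move=> k; split; first exact: (fD k).1.
  by rewrite (Lpnorm_energy (fLV k)) (LpQnorm_energy (fD k).2) -EFinD ltry.
- exact: (cv f uL fLV).2 fu.
- exact: (cq f gL (fun k => (fD k).2)).2 fg.
Qed.

Lemma mean_zero_iff (u : T -> R) : in_L mu (E : set T) p SV (lift u) ->
  (\int[mu]_(x in E) (u x * v x)%:E = 0)%E <->
  pairing mu (E : set T) p SV (lift (fun _ : T => 1)) (lift u) = 0.
Proof.
move=> uL; rewrite pairing_one (integral_Rintegral mE (integrable_mean uL)).
by split=> [[]|->].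
Qed.

Local Notation gradE := (@grad R n : (T -> R) -> T -> 'cV[R]_n.+1).

Lemma in_Htilde_iff (u : T -> R) (g : T -> 'cV[R]_n.+1) : in_Htilde E v Q p u g <->
  in_space mu (E : set T) p SV SQ test_function gradE u g /\
  pairing mu (E : set T) p SV (lift (fun _ : T => 1)) (lift u) = 0.
Proof.
split=> [[/in_H_iff Hs u0]|[Hs u0]]; have [uL _ _] := Hs.
  by split => //; exact: (mean_zero_iff uL).1.
by split; [exact: (in_H_iff u g).2 | exact: (mean_zero_iff uL).2].
Qed.

Lemma in_Htilde_test (phi : T -> R) : C1_closure E phi ->
  in_Htilde E v Q p phi (grad phi) <->
  test_function phi /\
  pairing mu (E : set T) p SV (lift (fun _ : T => 1)) (lift phi) = 0.
Proof.
move=> phiC; split=> [/in_Htilde_iff[[_ gL _] p0']|[[_ gL] p0']].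
  by split; [split|].
have pL := C1_closure_in_L phiC.
apply: (in_Htilde_iff phi (grad phi)).2; split; last exact: p0'.
split; [exact: pL | exact: gL | exists (fun=> phi); split].
- by move=> _; split.
- apply: (cvg_ext (b := fun=> 0)); last exact: cvg_cst.
  by move=> k; apply: (energy_eq0 mu SV p0) => x _; rewrite liftB subrr.
- apply: (cvg_ext (b := fun=> 0)); last exact: cvg_cst.
  by move=> k; apply: (energy_eq0 mu SQ p0) => x _; rewrite subrr.
Qed.

Lemma weak_solution_iff (f u : T -> R) (g : T -> 'cV[R]_n.+1) :
  in_L mu (E : set T) p SV (lift f) ->
  weak_solution E v Q p f u g <->
  abstract_weak_solution mu (E : set T) p SV SQ test_function gradE f u g.
Proof.
move=> fL.
have eqn (phi : T -> R) : in_L mu (E : set T) p SQ g -> test_function phi ->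
    (\int[mu]_(x in E) (enorm (mxsqrt (Q x) *m g x) `^ (p - 2) *
        ((grad phi x)^T *m Q x *m g x) 0 0)%:E =
     - \int[mu]_(x in E) (`|f x| `^ (p - 2) * f x * phi x * v x)%:E)%E <->
    pairing mu (E : set T) p SQ g (grad phi) =
    - pairing mu (E : set T) p SV (lift f) (lift phi).
  move=> gL [phiC pgL]; have phiL := C1_closure_in_L phiC.
  have i1 := integrable_pinner mE p_gt1 SQ_sym measurable_SQ_sqr gL pgL.
  have i2 := integrable_pinner mE p_gt1 SV_sym measurable_SV_sqr fL phiL.
  have -> : (\int[mu]_(x in E) (enorm (mxsqrt (Q x) *m g x) `^ (p - 2) *
      ((grad phi x)^T *m Q x *m g x) 0 0)%:E)%E =
      (pairing mu (E : set T) p SQ g (grad phi))%:E.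
    rewrite pairingE -(integral_Rintegral mE i1); apply: eq_integral => x /[!inE] Ex.
    by rewrite /pinner SQ_sqr.
  have -> : (\int[mu]_(x in E) (`|f x| `^ (p - 2) * f x * phi x * v x)%:E)%E =
      (pairing mu (E : set T) p SV (lift f) (lift phi))%:E.
    rewrite pairingE -(integral_Rintegral mE i2); apply: eq_integral => x /[!inE] Ex.
    by rewrite pinner_lift.
  by rewrite -EFinN; split=> [[]|->].
split=> [[/in_Htilde_iff[Hs u0] ws]|[Hs u0 ws]]; have [_ gL _] := Hs.
  split; [exact: Hs | exact: u0 | move=> phi phiD phi0].
  apply: (eqn phi gL phiD).1; apply: ws; first exact: phiD.1.
  exact: (in_Htilde_test phiD.1).2.
split; first exact: (in_Htilde_iff u g).2.
move=> phi phiC /(in_Htilde_test phiC)[phiD phi0].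
apply: (eqn phi gL phiD).2; exact: ws.
Qed.

(** The norms are p-th roots of the energies, so a constant K for norms becomes K^p for energies,
    and K for energies becomes K^(1/p). *)
Lemma neumann_property_iff : neumann_property E v Q p <->
  abstract_neumann mu (E : set T) p SV SQ test_function gradE.
Proof.
have powK (a : R) : 0 <= a -> (a `^ p^-1) `^ p = a.
  by move=> a0; rewrite -powRrM mulVf ?gt_eqF// powRr1.
split=> [[exs [K K0 HK]]|[exs [K K0 HK]]]; split.
- move=> f fL; have [u [g ws]] := exs f ((in_Lp_iff f).2 fL).
  by exists u, g; exact: (weak_solution_iff u g fL).1.
- exists (K `^ p); first exact: powR_gt0.
  move=> f fL u g ws; have [[uL _ _] _ _] := ws.
  have := HK f ((in_Lp_iff f).2 fL) u g ((weak_solution_iff u g fL).2 ws).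
  rewrite (Lpnorm_energy fL) (Lpnorm_energy uL) -EFinM lee_fin.
  have := energy_ge0 mu (E : set T) p SV (lift (u : T -> R)).
  have := energy_ge0 mu (E : set T) p SV (lift (f : T -> R)).
  move: (energy _ _ _ _ (lift (f : T -> R))) (energy _ _ _ _ (lift (u : T -> R))) => a b a0 b0 H.
  have := powR_le (ltW p0) (powR_ge0 b p^-1) H.
  by rewrite powRM ?powR_ge0 ?(ltW K0)// !powK.
- move=> f /in_Lp_iff fL; have [u [g ws]] := exs f fL.
  by exists u, g; exact: (weak_solution_iff u g fL).2.
- exists (K `^ p^-1); first exact: powR_gt0.
  move=> f /in_Lp_iff fL u g /(weak_solution_iff u g fL) ws; have [[uL _ _] _ _] := ws.
  have := HK f fL u g ws.
  rewrite (Lpnorm_energy fL) (Lpnorm_energy uL) -EFinM lee_fin.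
  have := energy_ge0 mu (E : set T) p SV (lift (u : T -> R)).
  have := energy_ge0 mu (E : set T) p SV (lift (f : T -> R)).
  move: (energy _ _ _ _ (lift (f : T -> R))) (energy _ _ _ _ (lift (u : T -> R))) => a b a0 b0 H.
  rewrite -powRM ?(ltW K0)//; exact: powR_le (ltW pi0) b0 H.
Qed.

Lemma vmean_pairing (f : T -> R) : vmean E v f =
  (vmass E v)^-1 * pairing mu (E : set T) p SV (lift (fun _ : T => 1)) (lift f).
Proof. by rewrite pairing_one. Qed.

Lemma integral_energy_lift (f : T -> R) : in_L mu (E : set T) p SV (lift f) ->
  (\int[mu]_(x in E) (`|f x| `^ p * v x)%:E =
   (energy mu (E : set T) p SV (lift f))%:E)%E.
Proof.
move=> fL; rewrite energyE -(integral_Rintegral mE fL.2).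
by apply: eq_integral => x /[!inE] Ex; rewrite pnorm_lift.
Qed.

Lemma integral_energy (g : T -> 'cV[R]_n.+1) : in_L mu (E : set T) p SQ g ->
  (\int[mu]_(x in E) (enorm (mxsqrt (Q x) *m g x) `^ p)%:E =
   (energy mu (E : set T) p SQ g)%:E)%E.
Proof. by move=> gL; rewrite energyE -(integral_Rintegral mE gL.2). Qed.

(** The abstract form speaks only of mean-zero functions of finite energy. Subtracting the mean
    reaches the other functions of finite energy, since the gradient does not change. *)
Lemma poincare_property_iff : poincare_property E v Q p <->
  abstract_poincare mu (E : set T) p SV SQ test_function gradE.
Proof.
split=> [[C C0 HC]|[C C0 HC]]; exists C => //.
  move=> f [fC gL] f0; have fL := C1_closure_in_L fC.
  have := HC f fC; rewrite vmean_pairing f0 mulr0.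
  under eq_integral do rewrite subr0.
  by rewrite (integral_energy_lift fL) (integral_energy gL) -EFinM lee_fin.
move=> f fC; have fL := C1_closure_in_L fC.
have [gL|gL] := pselect (in_L mu (E : set T) p SQ (grad f)); last first.
  (* If the gradient has infinite energy, the right side is +oo because C > 0. *)
  have mg := grad_measurable E_open fC.
  have mp := measurable_pnorm_powR SQ_sym measurable_SQ_sqr p mg.
  have -> : (\int[mu]_(x in E) (enorm (mxsqrt (Q x) *m grad f x) `^ p)%:E = +oo)%E.
    apply/eqP; rewrite -leye_eq leNgt; apply/negP => H; apply: gL; split; first exact: mg.
    apply: (integrable_iff_powR_lty mu pi0 (fun x _ => powR_ge0 _ _) mp).2.
    exact: poweR_lty.
  by rewrite gt0_muley ?lte_fin// leey.
pose c := vmean E v f; pose phi : T -> R := fun x => - c * 1 + f x.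
have phiD : test_function phi.
  exact: (test_function_lin (- c) (test_function_cst 1) (conj fC gL)).
have phi0 : pairing mu (E : set T) p SV (lift (fun _ : T => 1)) (lift phi) = 0.
  rewrite /phi (BV_lin mE p_gt1 SV_sym measurable_SV_sqr (- c) one_L one_L fL).
  rewrite (pairingxx mu p_gt1 SV_sym) energy_one /c vmean_pairing.
  by rewrite mulrC mulrN mulrA mulfV ?gt_eqF ?vmass_gt0// mul1r addNr.
have phiL := C1_closure_in_L phiD.1.
have -> : (\int[mu]_(x in E) (`|f x - vmean E v f| `^ p * v x)%:E =
    \int[mu]_(x in E) (`|phi x| `^ p * v x)%:E)%E.
  by apply: eq_integral => x _; rewrite /phi mulr1 addrC.
rewrite (integral_energy_lift phiL) (integral_energy gL) -EFinM lee_fin.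
have <- : energy mu (E : set T) p SQ (grad phi) = energy mu (E : set T) p SQ (grad f).
  apply: (eq_energy mu p SQ) => x Ex.
  by rewrite (grad_lin (- c) (C1_closure_cst E 1) fC Ex) grad_cst scaler0 add0r.
exact: HC.
Qed.

Lemma neumann_property_iff_poincare_property :
  neumann_property E v Q p <-> poincare_property E v Q p.
Proof.
rewrite neumann_property_iff poincare_property_iff.
apply: (neumann_iff_poincare mE p_gt1 SV_sym SQ_sym measurable_SV_sqr measurable_SQ_sqr).
- by move=> f [fC _]; exact: C1_closure_in_L.
- by move=> f [].
- exact: test_function_lin.
- by move=> a f g [fC _] [gC _]; exact: grad_lin.
- exact: test_function_cst.
- by move=> x _; exact: grad_cst.
- by rewrite energy_one; exact: vmass_gt0.
Qed.

End neumann_poincare.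

Unset Implicit Arguments.
Set Strict Implicit.
Set Printing Implicit Defensive.

Theorem theorem1p3 (R : realType) (n : nat) (Omega E : set 'rV[R]_n.+1)
    (Q : 'rV[R]_n.+1 -> 'M[R]_n.+1) (v : 'rV[R]_n.+1 -> R) (p : R)
    (Omega_open : open Omega) (Omega_connected : connected Omega)
    (E_open : open E) (E_bounded : bounded_set E)
    (E_Omega : closure E `<=` Omega)
    (Q_psd : forall x, Omega x -> psd (Q x))
    (Q_meas : forall i j, measurable_fun (Omega : set (lebesgue_space R n))
                            ((fun x => Q x i j) : lebesgue_space R n -> R))
    (v_weight : weight Omega v)
    (v_E : (0 < \int[@lebesgue_nd R n]_(x in E) (v x)%:E)%E)
    (p_gt1 : 1 < p)
    (gamma_loc : loc_integrable E (fun x => opnorm (Q x) `^ (p / 2))) :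
  neumann_property E v Q p <-> poincare_property E v Q p.
Proof.
exact: (neumann_property_iff_poincare_property Omega_open E_open E_bounded
  E_Omega Q_psd Q_meas v_weight v_E p_gt1).
Qed.
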